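(* Let $(A^+,\Delta)$ be a monoidal Garside structure with Garside group $A$, and assume that $A^+$ has a $\nu$-structure (one also says that $A$ has a $\nu$-structure). Then the positive ribbon category $\mathcal{R}^+(A^+)$ is a Garside category, and the ribbon groupoid $\mathcal{R}(A)$ is the associated Garside groupoid (i.e. the groupoid of formal inverses of $\mathcal{R}^+(A^+)$, via $A_X^+\mapsto A_X$ on objects and $g\mapsto g$ on morphisms).
   Context: All categories are small and composition is written from left to right: for $v:x\to y$ and $w:y\to z$ the composite is $vw:x\to z$. For a category $\mathcal{C}$, $\mathcal{C}_{x\to y}$ is the set of morphisms from $x$ to $y$, and $\mathcal{C}_{x\to\cdot}$, $\mathcal{C}_{\cdot\to x}$ are the sets of morphisms with source $x$, resp. target $x$. A natural transformation $\Delta$ from a functor $F$ to a functor $G$ satisfies $\Delta(x)G(v)=F(v)\Delta(y)$ for $v:x\to y$. A morphism $v$ left-divides $w$ if $w=vu$ for some $u$, right-divides $w$ if $w=uv$; $w$ is a factor of $w'$ if $w'=w_1ww_2$. $\mathcal{C}$ is noetherian if every infinite sequence $(w_i)$ of morphisms with $w_{i+1}$ a factor of $w_i$ for all $i$ is eventually constant. $\mathcal{C}$ is cancellative if composition on the left and on the right by any given morphism is injective. An atom is a non-identity morphism that is not a product of two non-identity morphisms. A categorical Garside structure is a pair $(\mathcal{C},\Delta)$ such that: $\mathcal{C}$ is a noetherian cancellative category equipped with an automorphism $\Phi$, and $\Delta$ is a natural transformation from $\mathrm{Id}_{\mathcal{C}}$ to $\Phi$; for every object $x$, $\mathcal{C}_{x\to\cdot}$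 and $\mathcal{C}_{\cdot\to x}$ are lattices for left-divisibility and right-divisibility respectively; for every atom $v\in\mathcal{C}_{x\to y}$ there is $\overline v\in\mathcal{C}_{y\to\Phi(x)}$ with $v\overline v=\Delta(x)$ and $\overline v\,\Phi(v)=\Delta(y)$. Then $\mathcal{C}$ is called a Garside category, and its groupoid of formal inverses $\mathcal{G}(\mathcal{C})$ the associated Garside groupoid; $\mathcal{C}$ embeds in $\mathcal{G}(\mathcal{C})$. If $\mathcal{C}$ has one object, $(\mathcal{C},\Delta)$ is a monoidal Garside structure, $\mathcal{C}$ is a Garside monoid, $\mathcal{G}(\mathcal{C})$ (its group of fractions) is a Garside group, and $\Delta$ is the Garside element. Let $(A^+,\Delta)$ be a monoidal Garside structure, $S$ the set of atoms of $A^+$, $A$ its group of fractions. Let $\vee,\wedge$ (resp. $\tilde\vee,\tilde\wedge$) be lcm and gcd in $A^+$ for left- (resp. right-) divisibility. A submonoid $P$ of $A^+$ is parabolic if it is a sublattice of $A^+$ both for left-divisibility and for right-divisibility, and there is $\delta\in A^+$ with $\delta^{-1}P\delta=P$ such that the set of left-divisors of $\delta$ in $A^+$ equals $\{g\in P: g \text{ left-divides }\Delta\}$ and equals $\{\Delta\wedge p: p\in P\}$. The atoms of $P$ are the atoms of $A^+$ lying in $P$. Write $A_X^+$ for a parabolic submonoid with atom set $X\subseteq S$ and $A_X$ for the subgroup of $A$ it generates (a standard parabolic subgroup); $A_X\cap A^+=A_X^+$. The positive ribbon category $\mathcal{R}^+(A^+)$ has as objects the parabolic submonoids of $A^+$;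 morphisms from $A_X^+$ to $A_Y^+$ are the $g\in A^+$ with $g^{-1}A_X^+g=A_Y^+$; composition is the product of $A^+$. The ribbon groupoid $\mathcal{R}(A)$ has as objects the standard parabolic subgroups $A_X$; morphisms from $A_X$ to $A_Y$ are the $g\in A$ with $g^{-1}A_X^+g=A_Y^+$; composition is the product of $A$. $A^+$ has a $\nu$-function if for each parabolic submonoid $A_X^+$ there is a map $\nu_X:S\to\mathcal{R}^+(A^+)_{A_X^+\to\cdot}$ such that: (1) each $\nu_X(s)$ is an atom of $\mathcal{R}^+(A^+)$; (2) for $s\in S$ and $g\in\mathcal{R}^+(A^+)_{A_X^+\to\cdot}$, if $s$ left-divides $g$ then $\nu_X(s)$ left-divides $g$; (3) for all $s,t\in S$, $\nu_X(s)\vee\nu_X(t)$ lies in $\mathcal{R}^+(A^+)_{A_X^+\to\cdot}$. $A^+$ has a $\tilde\nu$-function if for each $A_X^+$ there is a map $\tilde\nu_X:S\to\mathcal{R}^+(A^+)_{\cdot\to A_X^+}$ such that: (1) each $\tilde\nu_X(s)$ is an atom of $\mathcal{R}^+(A^+)$; (2) for $s\in S$ and $g\in\mathcal{R}^+(A^+)_{\cdot\to A_X^+}$, if $s$ right-divides $g$ then $\tilde\nu_X(s)$ right-divides $g$; (3) for all $s,t\in S$, $\tilde\nu_X(s)\tilde\vee\tilde\nu_X(t)$ lies in $\mathcal{R}^+(A^+)_{\cdot\to A_X^+}$. $A^+$ has a $\nu$-structure if it has both a $\nu$-function and a $\tilde\nu$-function. *)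

(* Defs.v *)
From mathcomp Require Import all_boot.
From mathcomp Require Import classical_sets.

Set Implicit Arguments.
Unset Strict Implicit.
Unset Printing Implicit Defensive.

Local Open Scope classical_set_scope.
Local Open Scope group_scope.

(* Composition is written from left to right: for f : x -> y and g : y -> z,
   cmp f g : x -> z. *)
Record category := Category {
  obj :> Type;
  hom : obj -> obj -> Type;
  idm : forall x, hom x x;
  cmp : forall x y z, hom x y -> hom y z -> hom x z;
  cmp1m : forall x y (f : hom x y), cmp (idm x) f = f;
  cmpm1 : forall x y (f : hom x y), cmp f (idm y) = f;
  cmpA : forall x y z t (f : hom x y) (g : hom y z) (h : hom z t),
    cmp f (cmp g h) = cmp (cmp f g) h }.

Arguments hom {c}.
Arguments idm {c}.
Arguments cmp {c x y z}.

Record functor (C D : category) := Functor {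
  fobj :> C -> D;
  fmor : forall x y : C, hom x y -> hom (fobj x) (fobj y);
  fmor1 : forall x, fmor (idm x) = idm (fobj x);
  fmorM : forall (x y z : C) (f : hom x y) (g : hom y z),
    fmor (cmp f g) = cmp (fmor f) (fmor g) }.

Arguments fmor {C D} f0 {x y} : rename.

Definition id_functor (C : category) : functor C C :=
  @Functor C C id (fun _ _ f => f) (fun _ => erefl) (fun _ _ _ _ _ => erefl).

Section FunctorComposition.
Variables (C D E : category) (F : functor C D) (G : functor D E).

Lemma comp_functor1 (x : C) : fmor G (fmor F (idm x)) = idm (G (F x)).
Proof. by rewrite !fmor1. Qed.

Lemma comp_functorM (x y z : C) (f : hom x y) (g : hom y z) :
  fmor G (fmor F (cmp f g)) = cmp (fmor G (fmor F f)) (fmor G (fmor F g)).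
Proof. by rewrite !fmorM. Qed.

Definition comp_functor : functor C E :=
  @Functor C E (fun x => G (F x)) (fun _ _ f => fmor G (fmor F f))
    comp_functor1 comp_functorM.
End FunctorComposition.

Definition from (C : category) (x : C) := {y : C & hom x y}.
Definition into (C : category) (y : C) := {x : C & hom x y}.
Definition mor (C : category) := {x : C & from x}.

Definition Mor (C : category) (x y : C) (f : hom x y) : mor C :=
  existT _ x (existT _ y f).
Definition src (C : category) (m : mor C) : C := projT1 m.
Definition tgt (C : category) (m : mor C) : C := projT1 (projT2 m).
Definition arrow (C : category) (m : mor C) : hom (src m) (tgt m) :=
  projT2 (projT2 m).

(* Equality of functors; comparing the morphisms together with their source
   and target, it covers the equality of the object maps. *)
Definition functor_eq (C D : category) (F G : functor C D) : Prop :=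
  forall (x y : C) (f : hom x y), Mor (fmor F f) = Mor (fmor G f).

Definition is_automorphism (C : category) (F : functor C C) : Prop :=
  exists G : functor C C,
    functor_eq (comp_functor F G) (id_functor C) /\
    functor_eq (comp_functor G F) (id_functor C).

Definition is_groupoid (C : category) : Prop :=
  forall (x y : C) (f : hom x y),
    exists g : hom y x, cmp f g = idm x /\ cmp g f = idm y.

(* G, with the functor I, is the groupoid of formal inverses of C: it is
   obtained from C by formally inverting all morphisms. *)
Definition is_groupoid_of_formal_inverses (C G : category)
    (I : functor C G) : Prop :=
  is_groupoid G /\
  forall D : category, is_groupoid D -> forall F : functor C D,
    exists H : functor G D,
      functor_eq (comp_functor I H) F /\
      forall H' : functor G D,
        functor_eq (comp_functor I H') F -> functor_eq H' H.

Section Lattice.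
Variables (T : Type) (le : T -> T -> Prop).

Definition is_join (a b j : T) : Prop :=
  [/\ le a j, le b j & forall c, le a c -> le b c -> le j c].

Definition is_meet (a b m : T) : Prop :=
  [/\ le m a, le m b & forall c, le c a -> le c b -> le c m].

Definition is_lattice : Prop :=
  [/\ forall a, le a a,
      forall a b, le a b -> le b a -> a = b,
      forall a b c, le a b -> le b c -> le a c,
      forall a b, exists j, is_join a b j
    & forall a b, exists m, is_meet a b m].

Definition is_sublattice (P : set T) : Prop :=
  (forall a b j, P a -> P b -> is_join a b j -> P j) /\
  (forall a b m, P a -> P b -> is_meet a b m -> P m).
End Lattice.

Section Divisibility.
Variable C : category.

Definition ldiv (x : C) (v w : from x) : Prop :=
  exists u : hom (projT1 v) (projT1 w), projT2 w = cmp (projT2 v) u.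

Definition rdiv (y : C) (v w : into y) : Prop :=
  exists u : hom (projT1 w) (projT1 v), projT2 w = cmp u (projT2 v).

Definition is_factor (w w' : mor C) : Prop :=
  exists (w1 : hom (src w') (src w)) (w2 : hom (tgt w) (tgt w')),
    arrow w' = cmp (cmp w1 (arrow w)) w2.

Definition is_noetherian : Prop :=
  forall w : nat -> mor C, (forall i, is_factor (w i.+1) (w i)) ->
    exists N, forall i, N <= i -> w i = w N.

Definition is_cancellative : Prop :=
  (forall (x y z : C) (f : hom x y) (g h : hom y z),
     cmp f g = cmp f h -> g = h) /\
  (forall (x y z : C) (f g : hom x y) (h : hom y z),
     cmp f h = cmp g h -> f = g).

Definition is_identity (x y : C) (f : hom x y) : Prop := Mor f = Mor (idm x).

Definition is_atom (x y : C) (f : hom x y) : Prop :=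
  ~ is_identity f /\
  forall (z : C) (u : hom x z) (v : hom z y),
    f = cmp u v -> is_identity u \/ is_identity v.
End Divisibility.

Record garside_structure (C : category) := GarsideStructure {
  Phi : functor C C;
  Delta : forall x : C, hom x (Phi x);
  garside_noetherian : is_noetherian C;
  garside_cancellative : is_cancellative C;
  Phi_automorphism : is_automorphism Phi;
  Delta_natural : forall (x y : C) (v : hom x y),
    cmp (Delta x) (fmor Phi v) = cmp v (Delta y);
  garside_ldiv_lattice : forall x : C, is_lattice (@ldiv C x);
  garside_rdiv_lattice : forall x : C, is_lattice (@rdiv C x);
  Delta_atom : forall (x y : C) (v : hom x y), is_atom v ->
    exists v' : hom y (Phi x),
      cmp v v' = Delta x /\ cmp v' (fmor Phi v) = Delta y }.

Definition is_garside_category (C : category) : Prop :=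
  inhabited (garside_structure C).

Definition deloop (M : monoidType) : category :=
  @Category unit (fun _ _ => M) (fun _ => 1) (fun _ _ _ a b => a * b)
    (fun _ _ => @mul1g M) (fun _ _ => @mulg1 M) (fun _ _ _ _ => @mulgA M).

Definition deloop_functor (M N : monoidType)
    (f : UMagmaMorphism.type M N) : functor (deloop M) (deloop N) :=
  @Functor (deloop M) (deloop N) id (fun _ _ => f)
    (fun _ => @gmulf1 M N f) (fun _ _ _ => @gmulfM M N f).

Definition monoidal_garside_structure (M : monoidType) :=
  garside_structure (deloop M).

Definition garside_element (M : monoidType)
    (G : monoidal_garside_structure M) : M := Delta G tt.

(* The group A, with the morphism j, is the group of fractions G(M) of M. *)
Definition is_group_of_fractions (M : monoidType) (A : groupType)
    (j : UMagmaMorphism.type M A) : Prop :=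
  is_groupoid_of_formal_inverses (deloop_functor j).

Definition atom_of (M : monoidType) :=
  {s : M | @is_atom (deloop M) tt tt s}.

Definition mldiv (M : monoidType) (a b : M) : Prop := exists c, b = a * c.
Definition mrdiv (M : monoidType) (a b : M) : Prop := exists c, b = c * a.

Definition is_submonoid (M : monoidType) (P : set M) : Prop :=
  P 1 /\ forall a b, P a -> P b -> P (a * b).

Definition is_subgroup (A : groupType) (H : set A) : Prop :=
  [/\ H 1, forall a b, H a -> H b -> H (a * b) & forall a, H a -> H a^-1].

(* g^-1 X g *)
Definition conj_set (A : groupType) (X : set A) (g : A) : set A :=
  [set x ^ g | x in X].

Lemma conj_set1 (A : groupType) (X : set A) : conj_set X 1 = X.
Proof.
rewrite /conj_set; apply/seteqP; split=> [_ [x Xx <-]|x Xx].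
  by rewrite conjg1.
by exists x; rewrite ?conjg1.
Qed.

Lemma conj_setM (A : groupType) (X : set A) (g h : A) :
  conj_set X (g * h) = conj_set (conj_set X g) h.
Proof.
rewrite /conj_set; apply/seteqP; split=> [_ [x Xx <-]|_ [_ [x Xx <-] <-]].
  by exists (x ^ g); [exists x | rewrite conjgM].
by exists x; rewrite ?conjgM.
Qed.

Lemma sig_val_inj (T : Type) (P : T -> Prop) (u v : {x : T | P x}) :
  proj1_sig u = proj1_sig v -> u = v.
Proof. exact: eq_sig_hprop (fun x => @boolp.Prop_irrelevance (P x)) u v. Qed.

Section Ribbons.
Variables (M : monoidType) (G : monoidal_garside_structure M).
Variables (A : groupType) (j : UMagmaMorphism.type M A).

Let D : M := garside_element G.

Definition is_parabolic (P : set M) : Prop :=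
  [/\ is_submonoid P,
      is_sublattice (@mldiv M) P,
      is_sublattice (@mrdiv M) P
    & exists d : M,
        [/\ conj_set (j @` P) (j d) = j @` P,
            [set g | mldiv g d] = [set g | P g /\ mldiv g D]
          & [set g | mldiv g d] =
            [set g | exists2 p, P p & is_meet (@mldiv M) D p g]]].

Definition parabolic := {P : set M | is_parabolic P}.

Definition positive_ribbon (P Q : parabolic) :=
  {g : M | conj_set (j @` proj1_sig P) (j g) = j @` proj1_sig Q}.

Lemma positive_ribbon1_subproof (P : parabolic) :
  conj_set (j @` proj1_sig P) (j 1) = j @` proj1_sig P.
Proof. by rewrite gmulf1 conj_set1. Qed.

Lemma positive_ribbonM_subproof (P Q R : parabolic)
    (g : positive_ribbon P Q) (h : positive_ribbon Q R) :
  conj_set (j @` proj1_sig P) (j (proj1_sig g * proj1_sig h)) =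
  j @` proj1_sig R.
Proof. by rewrite gmulfM conj_setM (proj2_sig g) (proj2_sig h). Qed.

Definition positive_ribbon1 (P : parabolic) : positive_ribbon P P :=
  exist _ 1 (positive_ribbon1_subproof P).

Definition positive_ribbonM (P Q R : parabolic)
    (g : positive_ribbon P Q) (h : positive_ribbon Q R) :
    positive_ribbon P R :=
  exist _ (proj1_sig g * proj1_sig h) (positive_ribbonM_subproof g h).

Lemma positive_ribbon1M (P Q : parabolic) (g : positive_ribbon P Q) :
  positive_ribbonM (positive_ribbon1 P) g = g.
Proof. exact/sig_val_inj/mul1g. Qed.

Lemma positive_ribbonM1 (P Q : parabolic) (g : positive_ribbon P Q) :
  positive_ribbonM g (positive_ribbon1 Q) = g.
Proof. exact/sig_val_inj/mulg1. Qed.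

Lemma positive_ribbonA (P Q R S : parabolic) (g : positive_ribbon P Q)
    (h : positive_ribbon Q R) (k : positive_ribbon R S) :
  positive_ribbonM g (positive_ribbonM h k) =
  positive_ribbonM (positive_ribbonM g h) k.
Proof. exact/sig_val_inj/mulgA. Qed.

Definition positive_ribbon_category : category :=
  Category positive_ribbon1M positive_ribbonM1 positive_ribbonA.

Definition generated_subgroup (X : set A) : set A :=
  smallest (@is_subgroup A) X.

Definition is_standard_parabolic (H : set A) : Prop :=
  exists2 P : set M, is_parabolic P & H = generated_subgroup (j @` P).

Definition standard_parabolic := {H : set A | is_standard_parabolic H}.

(* The parabolic submonoid A_X^+ (seen in A) is recovered from the subgroup
   A_X it generates as the intersection of A_X with A^+. *)
Definition positive_part (H : standard_parabolic) : set A :=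
  proj1_sig H `&` range j.

Definition ribbon (H K : standard_parabolic) :=
  {g : A | conj_set (positive_part H) g = positive_part K}.

Lemma ribbonM_subproof (H K L : standard_parabolic)
    (g : ribbon H K) (h : ribbon K L) :
  conj_set (positive_part H) (proj1_sig g * proj1_sig h) = positive_part L.
Proof. by rewrite conj_setM (proj2_sig g) (proj2_sig h). Qed.

Definition ribbon1 (H : standard_parabolic) : ribbon H H :=
  exist _ 1 (conj_set1 (positive_part H)).

Definition ribbonM (H K L : standard_parabolic)
    (g : ribbon H K) (h : ribbon K L) : ribbon H L :=
  exist _ (proj1_sig g * proj1_sig h) (ribbonM_subproof g h).

Lemma ribbon1M (H K : standard_parabolic) (g : ribbon H K) :
  ribbonM (ribbon1 H) g = g.
Proof. exact/sig_val_inj/mul1g. Qed.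

Lemma ribbonM1 (H K : standard_parabolic) (g : ribbon H K) :
  ribbonM g (ribbon1 K) = g.
Proof. exact/sig_val_inj/mulg1. Qed.

Lemma ribbonA (H K L N : standard_parabolic)
    (g : ribbon H K) (h : ribbon K L) (k : ribbon L N) :
  ribbonM g (ribbonM h k) = ribbonM (ribbonM g h) k.
Proof. exact/sig_val_inj/mulgA. Qed.

Definition ribbon_groupoid : category := Category ribbon1M ribbonM1 ribbonA.

Local Notation Rp := positive_ribbon_category.

Definition from_val (P : Rp) (g : from P) : M := proj1_sig (projT2 g).
Definition into_val (P : Rp) (g : into P) : M := proj1_sig (projT2 g).

Definition has_nu_function : Prop :=
  exists nu : forall P : Rp, atom_of M -> from P,
    [/\ forall P s, is_atom (projT2 (nu P s)),
        forall P s (g : from P),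
          mldiv (proj1_sig s) (from_val g) -> ldiv (nu P s) g
      & forall P s t m,
          is_join (@mldiv M) (from_val (nu P s)) (from_val (nu P t)) m ->
          exists g : from P, from_val g = m].

Definition has_nut_function : Prop :=
  exists nut : forall P : Rp, atom_of M -> into P,
    [/\ forall P s, is_atom (projT2 (nut P s)),
        forall P s (g : into P),
          mrdiv (proj1_sig s) (into_val g) -> rdiv (nut P s) g
      & forall P s t m,
          is_join (@mrdiv M) (into_val (nut P s)) (into_val (nut P t)) m ->
          exists g : into P, into_val g = m].

Definition has_nu_structure : Prop := has_nu_function /\ has_nut_function.
End Ribbons.

(* Main.v *)
(* Every element of M divides a power of D = Delta on both sides, so M embeds in A and
   every element of A is a fraction a D^-n. Parabolic submonoids are closed under
   factors, so a ribbon between standard parabolic subgroups is a positive ribbon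
   times some D^-n, which gives the universal property of the ribbon groupoid.
   The lattice conditions come from a general principle: in a noetherian
   cancellative category where any two morphisms with the same source have a
   common multiple, lcms of atoms suffice for all lcms and gcds. In the ribbon
   category every atom is some nu_X(s), and condition (3) provides these lcms. *)
Require Import Defs.
From mathcomp Require Import all_boot.
From mathcomp Require Import boolp classical_sets.

Set Implicit Arguments.
Unset Strict Implicit.
Unset Printing Implicit Defensive.

Local Open Scope classical_set_scope.

(** The group [A] is given only by its universal property, so facts about it come from well-chosen
    target groupoids. The bijections of a set of formal fractions show that [j] is injective. A
    subgroup of [A] containing the image of [j] is shown to be all of [A], since the map from [A] to
    it followed by the inclusion must be the identity. Closure of a parabolic [P] under factors is
    not in its definition. It comes from the element [d], which behaves inside [P] as Delta does in
    [M]: it quasi-commutes with [P], and the atoms dividing elements of [P] divide it. Condition (3)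
    speaks of an lcm taken in [M]. This is also the lcm among ribbons, because a quotient in [M] of
    one ribbon by another is again a ribbon, so the two divisibilities agree. *)

Lemma existT_inj (T : Type) (P : T -> Type) (x : T) (u v : P x) :
  existT P x u = existT P x v -> u = v.
Proof.
move=> e; have := projT2_eq e.
by rewrite (Prop_irrelevance (projT1_eq e) erefl).
Qed.

(** * Lattices of divisors in noetherian cancellative categories *)

Section FromSource.
Variable C : category.

Definition one_from (x : C) : from x := existT _ x (idm x).

(** Packing the target with the morphism makes composites with different targets comparable by plain
    equality. *)
Definition comp_from (x : C) (u : from x) (v : from (projT1 u)) : from x :=
  existT _ (projT1 v) (cmp (projT2 u) (projT2 v)).

Lemma ldivP (x : C) (u v : from x) :
  ldiv u v <-> exists w : from (projT1 u), v = comp_from w.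
Proof.
split=> [[w e]|[w ->]]; last by exists (projT2 w).
exists (existT _ (projT1 v) w); rewrite /comp_from /= -e {e}.
by case: (v).
Qed.

Lemma comp_from_one (x : C) (u : from x) : comp_from (one_from (projT1 u)) = u.
Proof. by case: u => y f; rewrite /comp_from /= cmpm1. Qed.

Lemma comp_one_from (x : C) (u : from x) : @comp_from x (one_from x) u = u.
Proof. by case: u => y f; rewrite /comp_from /= cmp1m. Qed.

Lemma comp_fromA (x : C) (u : from x) (v : from (projT1 u)) (w : from (projT1 v)) :
  comp_from (u := u) (comp_from w) = comp_from (u := comp_from v) w.
Proof. by rewrite /comp_from /= cmpA. Qed.

Lemma is_identityE (x y : C) (f : hom x y) :
  is_identity f <-> existT _ y f = one_from x.
Proof.
split=> [e|e]; first exact: existT_inj e.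
by rewrite /is_identity /Mor e.
Qed.

Lemma ldiv_refl (x : C) (u : from x) : ldiv u u.
Proof. by exists (idm _); rewrite cmpm1. Qed.

Lemma ldiv_trans (x : C) (u v w : from x) : ldiv u v -> ldiv v w -> ldiv u w.
Proof. by move=> [a ea] [b eb]; exists (cmp a b); rewrite eb ea cmpA. Qed.

Lemma one_ldiv (x : C) (u : from x) : ldiv (one_from x) u.
Proof. by exists (projT2 u); rewrite cmp1m. Qed.

End FromSource.

Arguments one_from {C} x.
Arguments comp_from {C x} u v.

Section Noetherian.
Variable C : category.
Hypotheses (C_noeth : is_noetherian C) (C_canc : is_cancellative C).

(** The sequence alternating between [m'] and [m] is a chain of factors, hence eventually
    constant. *)
Lemma is_factor_anti (m m' : mor C) : is_factor m m' -> is_factor m' m -> m = m'.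
Proof.
move=> h h'.
have [|N wN] := @C_noeth (fun i => if odd i then m else m').
  by move=> i /=; case: (odd i).
have := wN N.+1 (leqnSn N).
by rewrite /=; case: (odd N).
Qed.

Definition proper_factor (m m' : mor C) := is_factor m m' /\ m <> m'.

(** A non-accessible morphism would yield, by choice, an infinite chain of proper factors. *)
Lemma proper_factor_wf : well_founded proper_factor.
Proof.
move=> m0; apply: contrapT => nacc0.
have /choice[next nextP] (m : mor C) : exists m',
    ~ Acc proper_factor m -> proper_factor m' m /\ ~ Acc proper_factor m'.
  case: (pselect (Acc proper_factor m)) => [?|nacc]; first by exists m.
  apply: contrapT => none; apply: nacc; constructor=> m' m'm.
  by apply: contrapT => nacc'; apply: none; exists m'.
have nacc i : ~ Acc proper_factor (iter i next m0).
  by elim: i => //= i /nextP[].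
have [|N wN] := @C_noeth (fun i => iter i next m0).
  by move=> i; have [[]] := nextP _ (nacc i).
by have [[_ /= ne] _] := nextP _ (nacc N); exact: ne (wN N.+1 (leqnSn N)).
Qed.

Lemma comp_from_inj (x : C) (u : from x) : injective (comp_from u).
Proof.
move=> [y v] [z w] /= e.
have ? : y = z by exact: (existT_inj1 e).
by subst z; congr existT; exact: C_canc.1 (existT_inj e).
Qed.

Lemma comp_from_one_id (x : C) (u : from x) (v : from (projT1 u)) :
  comp_from u v = u -> v = one_from _.
Proof. by move=> e; apply: (@comp_from_inj _ u); rewrite comp_from_one. Qed.

Lemma is_factor_ldiv (x : C) (u v : from x) :
  ldiv u v -> is_factor (existT _ x u) (existT _ x v).
Proof. by case=> w e; exists (idm x), w; rewrite cmp1m. Qed.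

Lemma is_factor_comp_from (x : C) (u : from x) (v : from (projT1 u)) :
  is_factor (existT _ _ v) (existT _ x (comp_from u v)).
Proof. by exists (projT2 u), (idm _); rewrite cmpm1. Qed.

Lemma ldiv_anti (x : C) (u v : from x) : ldiv u v -> ldiv v u -> u = v.
Proof.
move=> uv vu; apply: (@existT_inj _ (fun x => from x) x).
by apply: is_factor_anti; apply: is_factor_ldiv.
Qed.

Lemma proper_factor_left (x : C) (u : from x) (v : from (projT1 u)) :
  v <> one_from _ -> proper_factor (existT _ x u) (existT _ x (comp_from u v)).
Proof.
move=> v1; split; first by apply/is_factor_ldiv/ldivP; exists v.
by move/(@existT_inj _ (fun x => from x) x)/esym/comp_from_one_id.
Qed.

(** If the two packed morphisms were equal, [u] would be an endomorphism, and right cancellation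
    would make it the identity. *)
Lemma proper_factor_right (x : C) (u : from x) (v : from (projT1 u)) :
  u <> one_from x -> proper_factor (existT _ _ v) (existT _ x (comp_from u v)).
Proof.
case: u v => y f [z g]; rewrite /comp_from /= => f1; split.
  exact: (@is_factor_comp_from x (existT _ y f) (existT _ z g)).
move=> e; have exy : y = x by exact: (existT_inj1 e).
subst y; have eg := existT_inj (existT_inj e).
apply: f1; have : cmp (idm x) g = cmp f g by rewrite cmp1m.
by move/(C_canc.2 _ _ _ _ _ _) => <-.
Qed.

Lemma atom_ldiv_exists (x : C) (u : from x) :
  u <> one_from x -> exists a : from x, is_atom (projT2 a) /\ ldiv a u.
Proof.
(* The induction is on the packed morphism [m], so that the source may change along it. *)
move: {2}(existT _ x u : mor C) (erefl (existT _ x u : mor C)) => m.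
elim/(well_founded_ind proper_factor_wf): m x u => m IH x u mE u1.
case: (pselect (is_atom (projT2 u))) => [ua|uNa].
  by exists u; split=> //; apply: ldiv_refl.
have [z [f [g [uE f1 g1]]]] : exists z (f : hom x z) (g : hom z (projT1 u)),
    [/\ projT2 u = cmp f g, ~ is_identity f & ~ is_identity g].
  apply: contrapT => none; apply: uNa; split.
    by case: (u) u1 => y f /= f1 /is_identityE.
  move=> z f g uE; apply: contrapT => fg1; apply: none; exists z, f, g.
  by split=> // h; apply: fg1; [left|right].
have uE' : u = comp_from (existT _ z f) (existT _ _ g).
  by case: (u) g uE {g1} => y h /= g ->.
have [||a [aa af]] := IH (existT _ x (existT _ z f)) _ _ _ (erefl _).
- rewrite -mE {1}uE'; apply: (proper_factor_left (u := existT _ z f)).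
  by move/is_identityE.
- by move/is_identityE.
exists a; split=> //; apply: ldiv_trans af _.
by apply/ldivP; exists (existT _ _ g).
Qed.

(** A common multiple of [a u] and [a v] is a multiple of [a]; cancelling [a] leaves a common
    multiple of [u] and [v]. *)
Lemma is_join_comp_from (x : C) (a : from x) (u v w : from (projT1 a)) :
  is_join (@ldiv C _) u v w ->
  is_join (@ldiv C _) (comp_from a u) (comp_from a v) (comp_from a w).
Proof.
have mono p q : ldiv p q -> ldiv (comp_from a p) (comp_from a q).
  by case/ldivP=> r ->; apply/ldivP; exists r; rewrite comp_fromA.
case=> uw vw wmin; split; [exact: mono|exact: mono|].
move=> c /ldivP[u' cE]; move: (cE); rewrite -comp_fromA => cE'.
rewrite cE' => /ldivP[v' /esym]; rewrite -comp_fromA => /comp_from_inj vE.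
apply/mono/wmin; apply/ldivP; first by exists u'.
by exists v'.
Qed.

Lemma ldiv_comp_from (x : C) (a : from x) (u v : from (projT1 a)) :
  ldiv (comp_from a u) (comp_from a v) -> ldiv u v.
Proof.
case/ldivP=> r; rewrite -comp_fromA => /comp_from_inj ->.
by apply/ldivP; exists r.
Qed.

Hypothesis upper_bounds :
  forall (x : C) (u v : from x), exists w, ldiv u w /\ ldiv v w.
Hypothesis atom_joins : forall (x : C) (a b : from x),
  is_atom (projT2 a) -> is_atom (projT2 b) -> exists j, is_join (@ldiv C x) a b j.

Lemma is_join_onel (x : C) (u : from x) : is_join (@ldiv C x) (one_from x) u u.
Proof. by split=> //; [apply: one_ldiv|apply: ldiv_refl]. Qed.

Lemma is_join_sym (x : C) (u v w : from x) :
  is_join (@ldiv C x) u v w -> is_join (@ldiv C x) v u w.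
Proof. by case=> uw vw h; split=> // c vc uc; apply: h. Qed.

(* Induction on the common multiple [z]: the lcm of [a g'] and [b h'], with [a]
   and [b] atoms, is completed from [c = a v b] by lcms below proper right
   factors of [z]. *)
Lemma bounded_join (x : C) (z g h : from x) :
  ldiv g z -> ldiv h z -> exists j, is_join (@ldiv C x) g h j.
Proof.
move: {2}(existT _ x z : mor C) (erefl (existT _ x z : mor C)) => m.
elim/(well_founded_ind proper_factor_wf): m x z g h => m IH x z g h mE gz hz.
(* The induction hypothesis after division by [a]: what remains of [z] is a proper right factor. *)
have sub (a : from x) (u v : from (projT1 a)) : a <> one_from x ->
    ldiv (comp_from a u) z -> ldiv (comp_from a v) z ->
    exists j, is_join (@ldiv C _) u v j.
  move=> a1 /ldivP[w zE]; rewrite zE -comp_fromA => /ldiv_comp_from vz.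
  apply: (IH _ _ _ (comp_from u w) u v erefl _ vz).
    rewrite -mE zE -comp_fromA; exact: proper_factor_right.
  by apply/ldivP; exists w.
case: (pselect (g = one_from x)) => [->|g1].
  by exists h; apply: is_join_onel.
case: (pselect (h = one_from x)) => [->|h1].
  by exists g; apply/is_join_sym/is_join_onel.
have [a [aat ag]] := atom_ldiv_exists g1.
have [b [bat bh]] := atom_ldiv_exists h1.
have atom1 (c : from x) : is_atom (projT2 c) -> c <> one_from x.
  by move=> [c1 _] cE; apply: c1; apply/is_identityE; rewrite -cE; case: (c).
have [c cJ] := atom_joins aat bat.
have [ac bc cmin] := cJ.
have cz : ldiv c z by apply: cmin; [apply: ldiv_trans ag gz|apply: ldiv_trans bh hz].
(* Cancel the common divisor [d] of [k] and [c], join the quotients, and multiply back by [d]. *)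
have joinc (d k : from x) : d <> one_from x -> ldiv d k -> ldiv d c ->
    ldiv k z -> exists j, is_join (@ldiv C x) k c j.
  move=> d1 /ldivP[k' kE] /ldivP[c' cE] kz.
  have [||j jJ] := sub d k' c' d1; rewrite -?kE -?cE //.
  by exists (comp_from d j); rewrite kE cE; apply: is_join_comp_from.
have [gc [g_gc c_gc gcmin]] := joinc a g (atom1 _ aat) ag ac gz.
have [hc [h_hc c_hc hcmin]] := joinc b h (atom1 _ bat) bh bc hz.
have [gc' gcE] := (ldivP _ _).1 c_gc.
have [hc' hcE] := (ldivP _ _).1 c_hc.
have c1 : c <> one_from x.
  move=> cE; apply: (atom1 _ aat); apply: ldiv_anti (one_ldiv _).
  by rewrite -cE.
(* The lcms [gc] of [g, c] and [hc] of [h, c] share the divisor [c]. Their join is that of [g] and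
   [h], as [c] divides every common multiple of these. *)
have [||j /is_join_comp_from] := sub c gc' hc' c1; rewrite -?gcE -?hcE.
- exact: gcmin.
- exact: hcmin.
case=> gcj hcj jmin; exists (comp_from c j); split.
- exact: ldiv_trans gcj.
- exact: ldiv_trans hcj.
move=> d gd hd; have cd : ldiv c d.
  by apply: cmin; [apply: ldiv_trans ag gd|apply: ldiv_trans bh hd].
by apply: jmin; [apply: gcmin|apply: hcmin].
Qed.

Lemma ldiv_join (x : C) (g h : from x) : exists j, is_join (@ldiv C x) g h j.
Proof. by have [z [gz hz]] := upper_bounds g h; apply: bounded_join gz hz. Qed.

(* The join of a common divisor with a maximal one is again a common divisor,
   so that a maximal common divisor is a gcd. *)
Lemma ldiv_meet (x : C) (g h : from x) : exists m, is_meet (@ldiv C x) g h m.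
Proof.
suff [c [cg ch cmax]] : exists c : from x, [/\ ldiv c g, ldiv c h &
    forall d, ldiv d g -> ldiv d h -> ldiv c d -> d = c].
  exists c; split=> // d dg dh; have [e [ce de emin]] := ldiv_join c d.
  by rewrite -(cmax e) //; apply: emin.
(* Climb among common divisors [c], starting from the identity. The cofactor [r] with [c r = g]
   becomes a proper right factor of itself whenever [c] grows. *)
have [r] : exists r, comp_from (one_from x) r = g.
  by exists g; apply: comp_one_from.
move: (one_from x) (one_ldiv h) r => c ch r.
move: {2}(existT _ _ r : mor C) (erefl (existT _ _ r : mor C)) => m.
elim/(well_founded_ind proper_factor_wf): m c ch r => m IH c ch r mE rg.
case: (pselect (exists d, [/\ ldiv d g, ldiv d h, ldiv c d & d <> c])); last first.
  move=> cmax; exists c; split=> //; first by apply/ldivP; exists r.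
  move=> d dg dh cd; apply: contrapT => dc; apply: cmax.
  by exists d.
move=> [d [/ldivP[r' gE] dh /ldivP[k dE] dc]].
subst d; move: gE; rewrite -comp_fromA => gE.
apply: (IH _ _ _ dh r' erefl); last by rewrite -comp_fromA.
rewrite -mE.
have -> : r = comp_from k r' by apply: (@comp_from_inj _ c); rewrite rg.
by apply: proper_factor_right => kE; apply: dc; rewrite kE comp_from_one.
Qed.

Lemma ldiv_is_lattice (x : C) : is_lattice (@ldiv C x).
Proof.
split.
- exact: ldiv_refl.
- exact: ldiv_anti.
- exact: ldiv_trans.
- exact: ldiv_join.
- exact: ldiv_meet.
Qed.

End Noetherian.

(** * Right divisibility as left divisibility in the opposite category *)

Section Opposite.
Variable C : category.

Definition op_category : category :=
  @Category C (fun x y => hom y x) (@idm C) (fun x y z f g => cmp g f)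
    (fun x y f => cmpm1 f) (fun x y f => cmp1m f)
    (fun x y z t f g h => esym (cmpA h g f)).

Definition op_mor (m : mor op_category) : mor C :=
  Mor (arrow m : @hom C (tgt m) (src m)).

Lemma op_mor_inj (x y z t : C) (f : @hom C x y) (g : @hom C z t) :
  Mor f = Mor g -> @Mor op_category y x f = @Mor op_category t z g.
Proof.
move=> e; have exz : x = z by exact: (existT_inj1 e).
subst z; have e' := existT_inj e; have eyt : y = t by exact: (existT_inj1 e').
by subst t; rewrite (existT_inj e').
Qed.

Lemma op_noetherian : is_noetherian C -> is_noetherian op_category.
Proof.
move=> noeth w wf; have [|N wN] := noeth (fun i => op_mor (w i)).
  by move=> i; have [w1 [w2 e]] := wf i; exists w2, w1; rewrite -cmpA; exact: e.
exists N => i /wN /op_mor_inj.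
by case: (w i) (w N) => [? [? ?]] [? [? ?]].
Qed.

Lemma op_cancellative : is_cancellative C -> is_cancellative op_category.
Proof. by case=> cl cr; split=> ? ? ? ? ? ? /=; [apply: cr|apply: cl]. Qed.

Lemma is_identity_op (x y : C) (f : @hom C x y) :
  is_identity f -> @is_identity op_category y x f.
Proof.
move=> e; have exy : y = x by exact: (existT_inj1 (existT_inj e)).
by subst y; rewrite /is_identity (existT_inj (existT_inj e)).
Qed.

End Opposite.

(** The double opposite agrees with [C] by conversion on objects, morphisms and identities. *)
Lemma op_is_identity (C : category) (x y : C) (f : hom x y) :
  @is_identity (op_category C) y x f -> is_identity f.
Proof. exact: (@is_identity_op (op_category C) y x f). Qed.

Lemma op_is_atom (C : category) (x y : C) (f : hom x y) :
  @is_atom (op_category C) y x f -> is_atom f.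
Proof.
move=> [f1 fat]; split=> [e|z u v /fat[e|e]]; first exact/f1/is_identity_op.
- by right; apply: op_is_identity.
- by left; apply: op_is_identity.
Qed.

Lemma rdiv_is_lattice (C : category) (C_noeth : is_noetherian C)
    (C_canc : is_cancellative C)
    (upper_bounds : forall (x : C) (u v : into x), exists w, rdiv u w /\ rdiv v w)
    (atom_joins : forall (x : C) (a b : into x), is_atom (projT2 a) ->
       is_atom (projT2 b) -> exists j, is_join (@rdiv C x) a b j) (x : C) :
  is_lattice (@rdiv C x).
Proof.
apply: (@ldiv_is_lattice (op_category C)) => //.
- exact: op_noetherian.
- exact: op_cancellative.
- by move=> y a b /op_is_atom aat /op_is_atom bat; apply: atom_joins.
Qed.

Local Open Scope group_scope.

(** * Garside monoids *)

Section GarsideMonoid.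
Variables (M : monoidType) (G : monoidal_garside_structure M).

Local Notation D := (garside_element G).

(** By [delta_shift] below, this is conjugation by Delta, [D^-1 v D], expressed inside [M]. *)
Definition shift (v : M) : M := fmor (Phi G) (v : @hom (deloop M) tt tt).

Lemma shift1 : shift 1 = 1. Proof. exact: (fmor1 (Phi G) tt). Qed.

Lemma shiftM (v w : M) : shift (v * w) = shift v * shift w.
Proof. exact: (@fmorM _ _ (Phi G) tt tt tt). Qed.

Lemma shift_bij : exists shift' : M -> M, cancel shift shift' /\ cancel shift' shift.
Proof.
have [F [FK KF]] := Phi_automorphism G.
exists (fun v => fmor F (v : @hom (deloop M) tt tt)); split=> v.
  have /(congr1 (fun m : mor (deloop M) => arrow m : M)) := FK tt tt v.
  (* The object [Phi G tt] reduces to [tt] only after case analysis on [unit]. *)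
  by rewrite /= /shift; case: (Phi G tt).
have /(congr1 (fun m : mor (deloop M) => arrow m : M)) := KF tt tt v.
by rewrite /= /shift; case: (F tt).
Qed.

Definition shiftV : M -> M := projT1 (cid shift_bij).

Lemma shiftK : cancel shift shiftV.
Proof. by rewrite /shiftV; case: cid => ? []. Qed.

Lemma shiftVK : cancel shiftV shift.
Proof. by rewrite /shiftV; case: cid => ? []. Qed.

Lemma shiftV1 : shiftV 1 = 1.
Proof. by apply: (can_inj shiftK); rewrite shiftVK shift1. Qed.

Lemma shiftVM (v w : M) : shiftV (v * w) = shiftV v * shiftV w.
Proof. by apply: (can_inj shiftK); rewrite shiftM !shiftVK. Qed.

Lemma mulMI (a : M) : injective (fun b => a * b).
Proof. exact: ((garside_cancellative G).1 tt tt tt). Qed.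

Lemma mulIM (a : M) : injective (fun b => b * a).
Proof. by move=> b c; apply: ((garside_cancellative G).2 tt tt tt). Qed.

Lemma delta_shift (v : M) : D * shift v = v * D.
Proof. exact: (@Delta_natural _ G tt tt). Qed.

Lemma shift_delta : shift D = D.
Proof. by apply: (mulMI (a := D)); rewrite delta_shift. Qed.

Lemma shiftV_delta : shiftV D = D.
Proof. by apply: (can_inj shiftK); rewrite shiftVK shift_delta. Qed.

Lemma deltaX_shift (n : nat) (v : M) : D ^+ n * iter n shift v = v * D ^+ n.
Proof.
elim: n v => [|n IH] v; first by rewrite mul1g mulg1.
by rewrite iterSr expgSr -mulgA -iterSr iterS delta_shift mulgA IH -mulgA.
Qed.

Lemma is_identity_deloop (s : M) :
  @is_identity (deloop M) tt tt s <-> s = 1.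
Proof.
by split=> [/(congr1 (fun m : mor (deloop M) => arrow m : M))|->].
Qed.

Lemma atom_mldiv_exists (g : M) :
  g <> 1 -> exists s : atom_of M, mldiv (proj1_sig s) g.
Proof.
move=> g1; have [|[[] a] [aat [u e]]] := @atom_ldiv_exists (deloop M)
    (garside_noetherian G) (garside_cancellative G) tt (existT _ tt g).
  by move/is_identityE/is_identity_deloop.
by exists (exist _ a aat), u.
Qed.

(** Every element is a finite product of atoms: splitting off a left atom leaves a proper right
    factor. *)
Lemma atom_ind (P : M -> Prop) : P 1 ->
  (forall s g : M, @is_atom (deloop M) tt tt s -> P g -> P (s * g)) ->
  forall g, P g.
Proof.
move=> P1 PM g.
move: {2}(@Mor (deloop M) tt tt g) (erefl (@Mor (deloop M) tt tt g)) => m.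
elim/(well_founded_ind (proper_factor_wf (garside_noetherian G))): m g
  => m IH g mE.
case: (pselect (g = 1)) => [->//|/atom_mldiv_exists[[s sat] /= [h gE]]].
rewrite gE; apply: PM => //; apply: (IH _ _ _ erefl); rewrite -mE gE.
apply: (@proper_factor_right (deloop M)
  (garside_cancellative G) tt (existT _ tt s) (existT _ tt h)).
by move/is_identityE; case: sat.
Qed.

Lemma atom_mrdiv_exists (g : M) :
  g <> 1 -> exists s : atom_of M, mrdiv (proj1_sig s) g.
Proof.
elim/atom_ind: g => // s g sat IH _; case: (pselect (g = 1)) => [->|/IH[t [h ->]]].
  by exists (exist _ s sat), 1; rewrite mulg1 mul1g.
by exists t, (s * h); rewrite mulgA.
Qed.

Lemma mldiv_deltaX (g : M) : exists n, mldiv g (D ^+ n).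
Proof.
elim/atom_ind: g => [|s g sat [n [k Dn]]]; first by exists 0%N, 1; rewrite mulg1.
have [s' [sD _]] := Delta_atom G sat.
(* As [g k = D^n], moving the shifted [s'] leftwards across [D^n] turns it into [s'], and
   [s s' = D]. *)
exists n.+1, (k * iter n shift s').
rewrite -mulgA (mulgA g) -Dn deltaX_shift mulgA.
by rewrite expgS; congr (_ * _); symmetry; exact: sD.
Qed.

(** From [g k = D^n] follows [k shift^n(g) = D^n]; then apply the inverse of [shift^n], which fixes
    [D^n]. *)
Lemma mrdiv_deltaX (g : M) : exists n, mrdiv g (D ^+ n).
Proof.
have [n [k e]] := mldiv_deltaX g; exists n, (iter n shiftV k).
have {}e : k * iter n shift g = D ^+ n.
  by apply: (mulMI (a := g)); rewrite mulgA -e deltaX_shift.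
have iterVM m (a b : M) :
    iter m shiftV (a * b) = iter m shiftV a * iter m shiftV b.
  by elim: m => //= m ->; rewrite shiftVM.
have iterVK m (a : M) : iter m shiftV (iter m shift a) = a.
  by elim: m a => // m IH a; rewrite iterSr iterS shiftK IH.
have -> : D ^+ n = iter n shiftV (D ^+ n).
  elim: {2}n => //= m <-; elim: n {e} => [|n IH]; first by rewrite shiftV1.
  by rewrite expgS shiftVM shiftV_delta -IH.
by rewrite -e iterVM iterVK.
Qed.

Lemma mldiv_join (a b : M) : exists j, is_join (@mldiv M) a b j.
Proof.
have [_ _ _ /(_ (existT _ tt a) (existT _ tt b))[[[] j] [aj bj jmin]] _] :=
  garside_ldiv_lattice G tt.
by exists j; split=> // c ac bc; apply: (jmin (existT _ tt c)).
Qed.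

Lemma mrdiv_join (a b : M) : exists j, is_join (@mrdiv M) a b j.
Proof.
have [_ _ _ /(_ (existT _ tt a) (existT _ tt b))[[[] j] [aj bj jmin]] _] :=
  garside_rdiv_lattice G tt.
by exists j; split=> // c ac bc; apply: (jmin (existT _ tt c)).
Qed.

Lemma mldiv_meet (a b : M) : exists m, is_meet (@mldiv M) a b m.
Proof.
have [_ _ _ _ /(_ (existT _ tt a) (existT _ tt b))[[[] m] [ma mb mmax]]] :=
  garside_ldiv_lattice G tt.
by exists m; split=> // c ca cb; apply: (mmax (existT _ tt c)).
Qed.

End GarsideMonoid.

(** * The group of fractions *)

Section Bijections.
Variable X : Type.

Definition bijection := {f : X -> X | bijective f}.

Definition id_bijection : bijection :=
  exist _ id (Bijective (fun=> erefl) (fun=> erefl)).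

(** In this order of composition, a left action of [M] is a functor. *)
Definition comp_bijection (f g : bijection) : bijection :=
  exist _ (proj1_sig f \o proj1_sig g) (bij_comp (proj2_sig f) (proj2_sig g)).

Lemma comp_id_bijection (f : bijection) : comp_bijection id_bijection f = f.
Proof. exact: sig_val_inj. Qed.

Lemma comp_bijection_id (f : bijection) : comp_bijection f id_bijection = f.
Proof. exact: sig_val_inj. Qed.

Lemma comp_bijectionA (f g h : bijection) :
  comp_bijection f (comp_bijection g h) = comp_bijection (comp_bijection f g) h.
Proof. exact: sig_val_inj. Qed.

Definition bijection_category : category :=
  @Category unit (fun _ _ => bijection) (fun _ => id_bijection)
    (fun _ _ _ => comp_bijection) (fun _ _ => comp_id_bijection)
    (fun _ _ => comp_bijection_id) (fun _ _ _ _ => comp_bijectionA).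

Lemma bijection_groupoid : is_groupoid bijection_category.
Proof.
move=> x y [f fbij]; have [g fK gK] := fbij.
exists (exist _ g (Bijective gK fK)); split; apply: sig_val_inj;
  by apply/funext => z /=.
Qed.

End Bijections.

Section SubgroupCategory.
Variables (A : groupType) (H : set A) (H_subgroup : is_subgroup H).

Definition subgroup_mul (u v : {x | H x}) : {x | H x} :=
  let: And3 _ HM _ := H_subgroup in
  exist _ _ (HM _ _ (proj2_sig u) (proj2_sig v)).

Definition subgroup_one : {x | H x} :=
  let: And3 H1 _ _ := H_subgroup in exist _ 1 H1.

Lemma val_subgroup_mul u v :
  proj1_sig (subgroup_mul u v) = proj1_sig u * proj1_sig v.
Proof. by rewrite /subgroup_mul; case: H_subgroup. Qed.

Lemma val_subgroup_one : proj1_sig subgroup_one = 1.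
Proof. by rewrite /subgroup_one; case: H_subgroup. Qed.

Lemma subgroup_mul1 u : subgroup_mul subgroup_one u = u.
Proof. by apply: sig_val_inj; rewrite val_subgroup_mul val_subgroup_one mul1g. Qed.

Lemma subgroup_mulr1 u : subgroup_mul u subgroup_one = u.
Proof. by apply: sig_val_inj; rewrite val_subgroup_mul val_subgroup_one mulg1. Qed.

Lemma subgroup_mulA u v w :
  subgroup_mul u (subgroup_mul v w) = subgroup_mul (subgroup_mul u v) w.
Proof. by apply: sig_val_inj; rewrite !val_subgroup_mul mulgA. Qed.

Definition subgroup_category : category :=
  @Category unit (fun _ _ => {x | H x}) (fun _ => subgroup_one)
    (fun _ _ _ => subgroup_mul) (fun _ _ => subgroup_mul1)
    (fun _ _ => subgroup_mulr1) (fun _ _ _ _ => subgroup_mulA).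

Lemma subgroup_groupoid : is_groupoid subgroup_category.
Proof.
have [_ _ HV] := H_subgroup.
move=> [] [] [y Hy]; exists (exist _ _ (HV _ Hy)).
by split; apply: sig_val_inj; rewrite /= val_subgroup_mul val_subgroup_one
  /= ?mulgV ?mulVg.
Qed.

Definition subgroup_inclusion : functor subgroup_category (deloop A) :=
  @Functor subgroup_category (deloop A) id (fun _ _ u => proj1_sig u)
    (fun _ => val_subgroup_one) (fun _ _ _ => val_subgroup_mul).

Variables (M : monoidType) (j : UMagmaMorphism.type M A) (Hj : forall a, H (j a)).

Definition corestriction (a : M) : {x | H x} := exist _ _ (Hj a).

Lemma corestriction1 : corestriction 1 = subgroup_one.
Proof. by apply: sig_val_inj; rewrite val_subgroup_one /= gmulf1. Qed.

Lemma corestrictionM a b :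
  corestriction (a * b) = subgroup_mul (corestriction a) (corestriction b).
Proof. by apply: sig_val_inj; rewrite val_subgroup_mul /= gmulfM. Qed.

Definition corestriction_functor : functor (deloop M) subgroup_category :=
  @Functor (deloop M) subgroup_category id (fun _ _ => corestriction)
    (fun _ => corestriction1) (fun _ _ _ => corestrictionM).
End SubgroupCategory.

Section Embedding.
Variables (M : monoidType) (G : monoidal_garside_structure M).

Local Notation D := (garside_element G).

(* [frac a n] stands for the fraction [a D^-n]; left multiplication acts by
   bijections on these, as every [g] left-divides a power of [D]. *)
Definition frac (a : M) (n : nat) : set (M * nat) :=
  [set p | p.1 * D ^+ n = a * D ^+ p.2].

(** A fraction is its equivalence class of pairs, so equality of fractions is equality of sets. *)
Definition fraction := {S : set (M * nat) | exists a n, S = frac a n}.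

Definition Frac (a : M) (n : nat) : fraction :=
  exist _ (frac a n) (ex_intro _ a (ex_intro _ n erefl)).

Lemma fraction_ind (P : fraction -> Prop) :
  (forall a n, P (Frac a n)) -> forall x, P x.
Proof.
move=> PF [S [a [n e]]]; subst S.
by rewrite (_ : exist _ _ _ = Frac a n) //; apply: sig_val_inj.
Qed.

Lemma mulgXC (c x : M) (n m : nat) : c * x ^+ n * x ^+ m = c * x ^+ m * x ^+ n.
Proof. by rewrite -!mulgA -!expgnDr addnC. Qed.

(** Transitivity of equality of fractions: after multiplication by [D^n], only powers of [D] have to
    be exchanged. *)
Lemma frac_trans (a b c : M) (n m k : nat) :
  c * D ^+ n = a * D ^+ k -> a * D ^+ m = b * D ^+ n -> c * D ^+ m = b * D ^+ k.
Proof.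
move=> ca ab; apply: (mulIM G (a := D ^+ n)) => /=.
by rewrite mulgXC ca mulgXC ab mulgXC.
Qed.

Lemma frac_eq (a b : M) (n m : nat) :
  a * D ^+ m = b * D ^+ n <-> Frac a n = Frac b m.
Proof.
split=> [e|/(congr1 (@proj1_sig _ _))/= e]; last first.
  by have : frac a n (a, n) by []; rewrite e.
apply: sig_val_inj; rewrite /= /frac; apply/seteqP; split=> -[c k] /= h.
  exact: frac_trans h e.
exact: frac_trans h (esym e).
Qed.

Lemma act_frac_set (g a : M) (n : nat) :
  [set p : M * nat | exists2 q, frac a n q & g * q.1 * D ^+ p.2 = p.1 * D ^+ q.2] =
  frac (g * a) n.
Proof.
apply/seteqP; split=> -[c k] /=; last by move=> e; exists (a, n).
case=> -[b m] /= bm e; apply: frac_trans (esym e) _.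
by rewrite -!mulgA bm.
Qed.

Lemma act_frac_subproof (g : M) (x : fraction) : exists a n,
  [set p : M * nat | exists2 q, proj1_sig x q &
    g * q.1 * D ^+ p.2 = p.1 * D ^+ q.2] = frac a n.
Proof.
by elim/fraction_ind: x => a n; exists (g * a), n; apply: act_frac_set.
Qed.

Definition act_frac (g : M) (x : fraction) : fraction :=
  exist _ _ (act_frac_subproof g x).

Lemma act_fracE (g a : M) (n : nat) : act_frac g (Frac a n) = Frac (g * a) n.
Proof. exact/sig_val_inj/act_frac_set. Qed.

Lemma act_frac_bij (g : M) : bijective (act_frac g).
Proof.
have act_inj : injective (act_frac g).
  elim/fraction_ind=> a n; elim/fraction_ind=> b m.
  rewrite !act_fracE => /frac_eq; rewrite -!mulgA => /(mulMI G) e.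
  exact/frac_eq.
have /choice[f fK] (x : fraction) : exists y, act_frac g y = x.
  elim/fraction_ind: x => b m; have [n [k e]] := mldiv_deltaX G g.
  (* Since [g k = D^n], the preimage of [b D^-m] is [k D^-n b D^-m], and moving [D^-n] past [b]
     shifts [b] by [n]. *)
  exists (Frac (k * iter n (shift G) b) (n + m)).
  rewrite act_fracE mulgA -e deltaX_shift; apply/frac_eq.
  by rewrite -mulgA -expgnDr.
by exists f => // x; apply: act_inj.
Qed.

Definition act_bijection (g : M) : bijection fraction :=
  exist _ _ (act_frac_bij g).

Lemma act_bijection1 : act_bijection 1 = id_bijection fraction.
Proof.
apply: sig_val_inj; apply/funext => /=.
by elim/fraction_ind=> a n; rewrite act_fracE mul1g.
Qed.

Lemma act_bijectionM (g h : M) :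
  act_bijection (g * h) = comp_bijection (act_bijection g) (act_bijection h).
Proof.
apply: sig_val_inj; apply/funext => /=.
by elim/fraction_ind=> a n; rewrite /= !act_fracE mulgA.
Qed.

Definition act_functor : functor (deloop M) (bijection_category fraction) :=
  @Functor (deloop M) (bijection_category fraction) id (fun _ _ => act_bijection)
    (fun _ => act_bijection1) (fun _ _ _ => act_bijectionM).

Variables (A : groupType) (j : UMagmaMorphism.type M A).
Hypothesis hA : is_group_of_fractions j.

(** The action on fractions factors through [j], and an element is recovered from its action on the
    fraction [1]. *)
Lemma group_of_fractions_inj : injective j.
Proof.
move=> a b jab.
have [H [HE _]] := hA.2 _ (@bijection_groupoid fraction) act_functor.
pose val (m : mor (bijection_category fraction)) : fraction -> fraction :=
  proj1_sig (arrow m).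
have /(congr1 val) ea := HE tt tt a; have /(congr1 val) eb := HE tt tt b.
move: ea eb; rewrite /val /= jab => -> /(congr1 (fun f => f (Frac 1 0))).
by rewrite !act_fracE => /frac_eq; rewrite !mulg1.
Qed.

Lemma quasi_commuteX (P : set M) (d : M) (n : nat) :
  (forall p, P p -> exists2 p', P p' & p * d = d * p') ->
  forall p, P p -> exists2 p', P p' & p * d ^+ n = d ^+ n * p'.
Proof.
move=> dP; elim: n => [|n IH] p Pp; first by exists p => //; rewrite mul1g mulg1.
have [p1 Pp1 e1] := dP p Pp; have [p2 Pp2 e2] := IH p1 Pp1.
by exists p2 => //; rewrite expgS mulgA e1 -mulgA e2 mulgA.
Qed.

(* The elements [j p j(d)^-n] form a subgroup as soon as [d] quasi-commutes
   with [P] and every element of [P] divides a power of [d]. *)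
Lemma fractions_subgroup (P : set M) (d : M) : is_submonoid P ->
  P d -> (forall p, P p -> exists2 p', P p' & p * d = d * p') ->
  (forall p, P p -> exists r n, P r /\ p * r = d ^+ n) ->
  is_subgroup [set x : A | exists p n, P p /\ x * j d ^+ n = j p].
Proof.
move=> [P1 PM] Pd dP divP.
have PX n : P (d ^+ n) by elim: n => // n IH; rewrite expgS; apply: PM.
split=> [|x y [p [n [Pp xE]]] [q [m [Pq yE]]]|x [p [n [Pp xE]]]].
- by exists 1, 0%N; split=> //; rewrite mulg1 gmulf1.
(* With [q d^n = d^n q'], the product [p d^-n q d^-m] becomes [p q' d^-(m+n)]. *)
- have [q' Pq' eq] := quasi_commuteX n dP Pq; exists (p * q'), (m + n)%N; split.
    exact: PM.
  by rewrite expgnDr mulgA -(mulgA x) yE -mulgA -gmulfXn -gmulfM eq !gmulfM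
    mulgA gmulfXn xE.
(* With [p r = d^k], the inverse of [p d^-n] is [d^n r d^-k]. *)
- have [r [k [Pr e]]] := divP p Pp; exists (d ^+ n * r), k; split.
    exact: PM.
  apply: (mulgI x); rewrite mulgA mulgV mul1g gmulfM gmulfXn mulgA xE.
  by rewrite -gmulfM e gmulfXn.
Qed.

(** The fractions form a subgroup [H] through which [j] factors. The resulting endomorphism of [A]
    via [H] agrees with the identity on the image of [j], so it is the identity and [H] is all of
    [A]. *)
Lemma frac_decomposition (x : A) : exists a n, x * j D ^+ n = j a.
Proof.
pose H := [set x : A | exists p n, [set: M] p /\ x * j D ^+ n = j p].
have H_subgroup : is_subgroup H.
  apply: fractions_subgroup => // p _.
    by exists (shift G p); rewrite ?delta_shift.
  by have [n [k e]] := mldiv_deltaX G p; exists k, n.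
have Hj a : H (j a) by exists a, 0%N; rewrite mulg1.
have A_groupoid : is_groupoid (deloop A).
  by move=> [] [] y; exists y^-1; rewrite /= mulgV mulVg.
have [F [FE _]] := hA.2 _ (@subgroup_groupoid _ _ H_subgroup)
  (corestriction_functor H_subgroup Hj).
have [T [_ T_unique]] := hA.2 _ A_groupoid (deloop_functor j).
have e1 : functor_eq (comp_functor (deloop_functor j) (id_functor (deloop A)))
    (deloop_functor j) by [].
have e2 : functor_eq (comp_functor (deloop_functor j)
    (comp_functor F (subgroup_inclusion H_subgroup))) (deloop_functor j).
  move=> y z a; have /= := congr1
    (fun m : mor (subgroup_category H_subgroup) => proj1_sig (arrow m)) (FE y z a).
  by case: y z a => [] [] a /= ->; case: (F tt).
have e := etrans (T_unique _ e2 tt tt x) (esym (T_unique _ e1 tt tt x)).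
have xE := congr1 (fun m : mor (deloop A) => arrow m : A) e.
have [a [n [_ xaE]]] : H x by rewrite -[x]xE; apply: (proj2_sig (fmor F _)).
by exists a, n.
Qed.

(** The relation [g^-1 P g = Q] stated inside [M], where cancellation and divisibility can be
    used. *)
Definition normalizes (P : set M) (g : M) (Q : set M) : Prop :=
  (forall p, P p -> exists2 q, Q q & p * g = g * q) /\
  (forall q, Q q -> exists2 p, P p & p * g = g * q).

Lemma conj_set_normalizes (P Q : set M) (g : M) :
  conj_set (j @` P) (j g) = j @` Q <-> normalizes P g Q.
Proof.
have conjE p q : j p ^ j g = j q <-> p * g = g * q.
  split=> [e|e]; last by rewrite /conjg -gmulfM e gmulfM mulKg.
  by apply: group_of_fractions_inj; rewrite !gmulfM -e conjgC.
split=> [e|[PQ QP]].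
  split=> [p Pp|q Qq].
    have : (j @` Q) (j p ^ j g) by rewrite -e; exists (j p) => //; exists p.
    by case=> q Qq /esym/conjE; exists q.
  have : conj_set (j @` P) (j g) (j q) by rewrite e; exists q.
  by case=> _ [p Pp <-] /conjE; exists p.
apply/seteqP; split=> [_ [_ [p Pp <-] <-]|_ [q Qq <-]].
  by have [q Qq /conjE ->] := PQ p Pp; exists q.
by have [p Pp /conjE <-] := QP q Qq; exists (j p) => //; exists p.
Qed.

End Embedding.

(** * Parabolic submonoids *)

Section Parabolic.
Variables (M : monoidType) (G : monoidal_garside_structure M).
Variables (A : groupType) (j : UMagmaMorphism.type M A).
Hypothesis hA : is_group_of_fractions j.

Local Notation D := (garside_element G).

Section OneParabolic.
Variables (P : set M) (P_parabolic : is_parabolic G j P).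

Let P_submonoid : is_submonoid P. Proof. by case: P_parabolic. Qed.
Let P_one : P 1. Proof. by case: P_submonoid. Qed.
Let P_mul a b : P a -> P b -> P (a * b).
Proof. by case: P_submonoid => _; apply. Qed.

(** For the last clause, an atom [s] below [p] divides [D], hence the gcd of [D] and [p], which
    divides [d]. *)
Lemma parabolic_garside_element : exists d : M,
  [/\ normalizes P d P, forall g, mldiv g d -> P g &
      forall s p : M, @is_atom (deloop M) tt tt s -> P p -> mldiv s p -> mldiv s d].
Proof.
case: P_parabolic => _ _ _ [d [dP dD dmeet]]; exists d; split.
- exact/(conj_set_normalizes G hA).
- by move=> g gd; have [] : [set g | P g /\ mldiv g D] g by rewrite -dD.
move=> s p sat Pp sp; have [m [mD mp mmax]] := mldiv_meet G D p.
have md : mldiv m d.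
  have : [set g | mldiv g d] m by rewrite dmeet /=; exists p.
  by [].
have sD : mldiv s D.
  by have [s' [e _]] := Delta_atom G sat; exists s'; exact: esym e.
have [k mE] := mmax _ sD sp; have [l ->] := md.
by exists (k * l); rewrite mE mulgA.
Qed.

Lemma parabolic_complements (d t : M) : normalizes P d P ->
  (forall g, mldiv g d -> P g) -> mldiv t d ->
  (exists2 v, P v & t * v = d) /\ (exists2 w, P w & w * t = d).
Proof.
move=> [dP Pd] dsub td; have Pt := dsub t td; have [v dE] := td.
have Pv : P v.
  (* Cancelling [t] in [t d = d t' = t v t'] shows that [v] left-divides [d]. *)
  have [t' Pt' e] := dP t Pt; apply: dsub; exists t'.
  by apply: (mulMI G (a := t)); rewrite /= mulgA -dE.
split; first by exists v.
(* Conjugating [t v = d] back by [d] gives [t0 v0 = d]; then [t0 v0 t = d t = t0 d], so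
   [v0 t = d]. *)
have [t0 Pt0 e0] := Pd t Pt; have [v0 Pv0 e1] := Pd v Pv.
have e2 : t0 * v0 = d.
  by apply: (mulIM G (a := d)); rewrite /= -mulgA e1 mulgA e0 -mulgA -dE.
exists v0 => //; apply: (mulMI G (a := t0)).
by rewrite mulgA e2 -e0.
Qed.

(* With [w t = d], conjugating [w p = d x] by [d] yields [x d]. *)
Lemma parabolic_cancel_atom (t x : M) : @is_atom (deloop M) tt tt t ->
  P (t * x) -> P t /\ exists2 q, P q & mldiv x q.
Proof.
have [d [dP dsub datom]] := parabolic_garside_element.
move=> tat Ptx; have td : mldiv t d by apply: (datom t _ tat Ptx); exists x.
split; first exact: dsub.
have [_ [w Pw wt]] := parabolic_complements dP dsub td.
have [q Pq e] := dP.1 _ (P_mul Pw Ptx).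
exists q => //; exists d; apply: (mulMI G (a := d)).
by rewrite -e !mulgA wt.
Qed.

(** After removal of an atom, the rest of [x] is only known to divide some new element of [P], so
    [p] must vary in the induction. *)
Lemma parabolic_mldiv (x p : M) : P p -> mldiv x p -> P x.
Proof.
elim/(atom_ind G): x p => // t x tat IH p Pp [z pE].
have [Pt [q Pq [c qE]]] : P t /\ exists2 q, P q & mldiv (x * z) q.
  by apply: parabolic_cancel_atom => //; rewrite mulgA -pE.
apply: P_mul => //; apply: (IH q) => //.
by exists (z * c); rewrite qE mulgA.
Qed.

(** Strip the left cofactor atom by atom; closure under left divisors brings each remainder back
    into [P]. *)
Lemma parabolic_mrdiv (x p : M) : P p -> mrdiv x p -> P x.
Proof.
move=> Pp [u pE]; move: Pp; rewrite {}pE.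
elim/(atom_ind G): u => [|t u tat IH]; first by rewrite mul1g.
rewrite -mulgA => /(parabolic_cancel_atom tat)[_ [q Pq uxq]].
exact: IH (parabolic_mldiv Pq uxq).
Qed.

(** The analogue of [mldiv_deltaX] inside [P], supplying the hypotheses of [fractions_subgroup]. *)
Lemma parabolic_fractions : exists d : M, [/\ P d,
  forall p, P p -> exists2 p', P p' & p * d = d * p' &
  forall p, P p -> exists r n, P r /\ p * r = d ^+ n].
Proof.
have [d [dP dsub datom]] := parabolic_garside_element; have [dP1 _] := dP.
exists d; split=> //; first by apply: dsub; exists 1; rewrite mulg1.
elim/(atom_ind G) => [_|t g tat IH Ptg]; first by exists 1, 0%N; rewrite mulg1.
have td : mldiv t d by apply: (datom t _ tat Ptg); exists g.
have [r [n [Pr rE]]] : exists r n, P r /\ g * r = d ^+ n.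
  by apply: IH; apply: parabolic_mrdiv Ptg _; exists t.
have [[v Pv tv] _] := parabolic_complements dP dsub td.
have [v' Pv' e] := quasi_commuteX n dP1 Pv.
exists (r * v'), n.+1; split; first exact: P_mul.
by rewrite -mulgA (mulgA g) rE -e mulgA tv -expgS.
Qed.

(** The generated subgroup consists of fractions [p d^-n]; if one equals [j m], then [m d^n = p] and
    [m] is a left divisor of [p]. *)
Lemma generated_subgroup_range (m : M) :
  generated_subgroup (j @` P) (j m) -> P m.
Proof.
have [d [Pd dP divP]] := parabolic_fractions.
have H_subgroup := fractions_subgroup j P_submonoid Pd dP divP.
have sub : j @` P `<=` [set x : A | exists p n, P p /\ x * j d ^+ n = j p].
  by move=> _ [p Pp <-]; exists p, 0%N; rewrite mulg1.
move/(_ _ (conj H_subgroup sub)) => /= -[p [n [Pp]]].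
rewrite -gmulfXn -gmulfM => /(group_of_fractions_inj G hA) e.
by apply: (parabolic_mldiv Pp); exists (d ^+ n).
Qed.

End OneParabolic.

Definition delta_automorphism (f g : M -> M) : Prop :=
  [/\ cancel f g, cancel g f, {morph f : x y / x * y} & f D = D].

Lemma delta_automorphism_sym f g : delta_automorphism f g -> delta_automorphism g f.
Proof.
move=> [fK gK fM fD]; split=> // [x y|]; apply: (can_inj fK).
  by rewrite fM !gK.
by rewrite gK fD.
Qed.

Lemma shift_automorphism : delta_automorphism (shift G) (shiftV G).
Proof.
split; [exact: shiftK|exact: shiftVK|exact: shiftM|exact: shift_delta].
Qed.

(** Parabolicity involves only products, divisibility and [D], all preserved by [f]. The element
    attached to the preimage is [g d]. *)
Lemma preimage_parabolic f g (P : set M) : delta_automorphism f g ->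
  is_parabolic G j P -> is_parabolic G j [set m | P (f m)].
Proof.
move=> fg; have [fK gK fM fD] := fg.
have [_ _ gM gD] := delta_automorphism_sym fg.
have f1 : f 1 = 1.
  by apply: (mulMI G (a := f 1)); rewrite -fM !mulg1.
have divl a b : mldiv (f a) (f b) <-> mldiv a b.
  split=> -[c e]; last by exists (f c); rewrite e fM.
  by exists (g c); apply: (can_inj fK); rewrite fM gK.
have divr a b : mrdiv (f a) (f b) <-> mrdiv a b.
  split=> -[c e]; last by exists (f c); rewrite e fM.
  by exists (g c); apply: (can_inj fK); rewrite fM gK.
have join_f (le : M -> M -> Prop) a b m :
    (forall x y, le (f x) (f y) <-> le x y) ->
    is_join le a b m -> is_join le (f a) (f b) (f m).
  move=> leE [am bm mmin]; split; [exact/leE|exact/leE|].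
  by move=> c; rewrite -[c]gK => /leE ac /leE bc; apply/leE/mmin.
have meet_f (le : M -> M -> Prop) a b m :
    (forall x y, le (f x) (f y) <-> le x y) ->
    is_meet le a b m -> is_meet le (f a) (f b) (f m).
  move=> leE [am bm mmin]; split; [exact/leE|exact/leE|].
  by move=> c; rewrite -[c]gK => /leE ac /leE bc; apply/leE/mmin.
have lattice_f (le : M -> M -> Prop) :
    (forall x y, le (f x) (f y) <-> le x y) ->
    is_sublattice le P -> is_sublattice le [set m | P (f m)].
  move=> leE [PJ PI]; split=> a b m Pa Pb h.
    exact: (PJ _ _ _ Pa Pb (join_f _ _ _ _ leE h)).
  exact: (PI _ _ _ Pa Pb (meet_f _ _ _ _ leE h)).
case=> [[P1 PM] Pl Pr [d [dP dD dmeet]]]; split.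
- by split=> [|a b] /=; rewrite ?f1 // fM; apply: PM.
- exact: lattice_f.
- exact: lattice_f.
move/seteqP: dD => [dD1 dD2]; move/seteqP: dmeet => [dm1 dm2].
have divd m : mldiv m (g d) <-> mldiv (f m) d.
  by rewrite -{2}(gK d); apply: iff_sym.
exists (g d); split.
- have /(conj_set_normalizes G hA)[PP1 PP2] := dP.
  apply/(conj_set_normalizes G hA); split=> p Pp.
    have [q Pq e] := PP1 _ Pp; exists (g q); first by rewrite /= gK.
    by apply: (can_inj fK); rewrite !fM !gK.
  have [q Pq e] := PP2 _ Pp; exists (g q); first by rewrite /= gK.
  by apply: (can_inj fK); rewrite !fM !gK.
- apply/seteqP; split=> m /=.
    by move/divd/dD1 => /= [Pm]; rewrite -{1}fD => /divl.
  by move=> [Pm mD]; apply/divd/dD2; split=> //; rewrite -{1}fD; apply/divl.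
- apply/seteqP; split=> m /=.
    move/divd/dm1 => /= [p Pp h]; exists (g p); first by rewrite gK.
    have [h1 h2 h3] := h; split.
    + by apply/divl; rewrite fD.
    + by apply/divl; rewrite gK.
    + move=> c /divl; rewrite fD => cD /divl; rewrite gK => cp.
      exact/divl/h3.
  move=> [p Pp h]; apply/divd/dm2; exists (f p) => //.
  by rewrite -{1}fD; apply: meet_f.
Qed.

End Parabolic.

(** * The positive ribbon category *)

Section RibbonCategory.
Variables (M : monoidType) (G : monoidal_garside_structure M).
Variables (A : groupType) (j : UMagmaMorphism.type M A).
Hypothesis hA : is_group_of_fractions j.

Local Notation D := (garside_element G).
Local Notation Rp := (positive_ribbon_category G j).

Lemma image_inj (P Q : set M) : j @` P = j @` Q -> P = Q.
Proof.
move=> e; apply/seteqP; split=> m Pm.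
  have : (j @` Q) (j m) by rewrite -e; exists m.
  by case=> q Qq /(group_of_fractions_inj G hA) <-.
have : (j @` P) (j m) by rewrite e; exists m.
by case=> q Qq /(group_of_fractions_inj G hA) <-.
Qed.

Lemma parabolic_eq (P Q : Rp) : j @` proj1_sig P = j @` proj1_sig Q -> P = Q.
Proof. by move=> e; apply/sig_val_inj/image_inj. Qed.

Lemma ribbon_Mor_eq (P Q P' Q' : Rp) (f : hom P Q) (f' : hom P' Q') :
  P = P' -> Q = Q' -> proj1_sig f = proj1_sig f' -> Mor f = Mor f'.
Proof.
by move=> eP eQ; subst P' Q' => /sig_val_inj ->.
Qed.

Lemma ribbon_from_eq (P : Rp) (u v : from P) : from_val u = from_val v -> u = v.
Proof.
case: u v => Q f [Q' f'] e; rewrite /from_val /= in e.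
have eQ : Q = Q' by apply: parabolic_eq; rewrite -(proj2_sig f) e (proj2_sig f').
by subst Q'; rewrite (sig_val_inj e).
Qed.

Lemma ribbon_divl (P Q R : Rp) (f : hom P Q) (h : hom P R) (c : M) :
  proj1_sig h = proj1_sig f * c -> exists k : hom Q R, proj1_sig k = c.
Proof.
move=> e; suff h' : conj_set (j @` proj1_sig Q) (j c) = j @` proj1_sig R.
  by exists (exist _ c h').
by rewrite -(proj2_sig f) -conj_setM -gmulfM -e (proj2_sig h).
Qed.

Lemma ribbon_divr (P Q R : Rp) (f : hom Q R) (h : hom P R) (c : M) :
  proj1_sig h = c * proj1_sig f -> exists k : hom P Q, proj1_sig k = c.
Proof.
move=> e; suff h' : conj_set (j @` proj1_sig P) (j c) = j @` proj1_sig Q.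
  by exists (exist _ c h').
have key : conj_set (conj_set (j @` proj1_sig P) (j c)) (j (proj1_sig f)) =
    conj_set (j @` proj1_sig Q) (j (proj1_sig f)).
  by rewrite (proj2_sig f) -conj_setM -gmulfM -e (proj2_sig h).
(* Conjugation by [f] can be cancelled: insert [f f^-1] on both sides. *)
rewrite -[LHS]conj_set1 -[RHS]conj_set1 -(mulgV (j (proj1_sig f))).
by rewrite conj_setM key -conj_setM.
Qed.

Lemma ribbon_into_eq (P : Rp) (u v : into P) : into_val u = into_val v -> u = v.
Proof.
case: u v => Q f [Q' f'] e; rewrite /into_val /= in e.
have [k k1] : exists k : hom Q' Q, proj1_sig k = 1.
  by apply: (ribbon_divr (f := f) (h := f')); rewrite mul1g.
have eQ : Q' = Q by apply: parabolic_eq; rewrite -(proj2_sig k) k1 gmulf1 conj_set1.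
by subst Q'; rewrite (sig_val_inj e).
Qed.

Lemma ribbon_ldivE (P : Rp) (u v : from P) :
  ldiv u v <-> mldiv (from_val u) (from_val v).
Proof.
split=> [[w e]|[c e]]; last have [k kc] := ribbon_divl e.
  by exists (proj1_sig w); rewrite /from_val e.
by exists k; apply: sig_val_inj; rewrite /= kc.
Qed.

Lemma ribbon_rdivE (P : Rp) (u v : into P) :
  rdiv u v <-> mrdiv (into_val u) (into_val v).
Proof.
split=> [[w e]|[c e]]; last have [k kc] := ribbon_divr e.
  by exists (proj1_sig w); rewrite /into_val e.
by exists k; apply: sig_val_inj; rewrite /= kc.
Qed.

(** The underlying elements stabilize in [M]; what remains is that sources and targets stabilize
    too, which holds because the cofactors become [1]. *)
Lemma ribbon_noetherian : is_noetherian Rp.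
Proof.
move=> w wf; pose val (m : mor Rp) : mor (deloop M) :=
  @Mor (deloop M) tt tt (proj1_sig (arrow m)).
have wE i : exists (w1 : hom (src (w i)) (src (w i.+1)))
    (w2 : hom (tgt (w i.+1)) (tgt (w i))),
    proj1_sig (arrow (w i)) =
    proj1_sig w1 * proj1_sig (arrow (w i.+1)) * proj1_sig w2.
  by have [w1 [w2 e]] := wf i; exists w1, w2; rewrite e.
have [|N wN] := @garside_noetherian _ G (fun i => val (w i)).
  by move=> i; have [w1 [w2 e]] := wE i; exists (proj1_sig w1), (proj1_sig w2).
have step i : N <= i -> w i.+1 = w i.
  move=> Ni; have [w1 [w2 e]] := wE i.
  have ei : proj1_sig (arrow (w i.+1)) = proj1_sig (arrow (w i)).
    have : val (w i.+1) = val (w i) by rewrite wN ?leqW // wN.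
    exact: (congr1 (fun m : mor (deloop M) => arrow m : M)).
  rewrite ei in e.
  (* With [m = w1 m w2], the elements [m] and [m w2] are factors of each other. *)
  have w21 : proj1_sig (arrow (w i)) * proj1_sig w2 = proj1_sig (arrow (w i)).
    suff : @Mor (deloop M) tt tt (proj1_sig (arrow (w i)) * proj1_sig w2) = val (w i).
      exact: (congr1 (fun m : mor (deloop M) => arrow m : M)).
    apply: (is_factor_anti (garside_noetherian G)).
      by exists (proj1_sig w1), 1; rewrite /= mulg1 mulgA.
    by exists 1, (proj1_sig w2); rewrite /= mul1g.
  rewrite -mulgA w21 in e.
  have {}w21 : proj1_sig w2 = 1.
    by apply: (mulMI G (a := proj1_sig (arrow (w i)))); rewrite /= w21 mulg1.
  have w11 : proj1_sig w1 = 1.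
    by apply: (mulIM G (a := proj1_sig (arrow (w i)))); rewrite /= -e mul1g.
  have srcE : src (w i) = src (w i.+1).
    by apply: parabolic_eq; rewrite -(proj2_sig w1) w11 gmulf1 conj_set1.
  have tgtE : tgt (w i.+1) = tgt (w i).
    by apply: parabolic_eq; rewrite -(proj2_sig w2) w21 gmulf1 conj_set1.
  have : Mor (arrow (w i.+1)) = Mor (arrow (w i)) by apply: ribbon_Mor_eq.
  by case: (w i) (w i.+1) {e ei srcE tgtE w1 w2 w11 w21} => [? [? ?]] [? [? ?]].
exists N => i; elim: i => [|i IH]; first by rewrite leqn0 => /eqP ->.
by rewrite leq_eqVlt => /predU1P[->//|/[!ltnS] Ni]; rewrite step // IH.
Qed.

Lemma ribbon_cancellative : is_cancellative Rp.
Proof.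
split=> P Q R f g h /(congr1 (fun k => proj1_sig k)) /= e; apply: sig_val_inj.
  exact: mulMI e.
exact: mulIM e.
Qed.

Lemma ribbon_is_identityE (P Q : Rp) (f : hom P Q) :
  is_identity f <-> proj1_sig f = 1.
Proof.
split=> [e|f1]; last first.
  apply: ribbon_Mor_eq => //; apply: parabolic_eq.
  by rewrite -(proj2_sig f) f1 gmulf1 conj_set1.
exact: (congr1 (fun m : mor Rp => proj1_sig (arrow m)) e).
Qed.

Lemma ribbon_atom_ldiv (P : Rp) (u a : from P) :
  is_atom (projT2 u) -> is_atom (projT2 a) -> ldiv u a -> u = a.
Proof.
move=> [u1 _] [_ aat] [w e]; have [/u1//|/ribbon_is_identityE w1] := aat _ _ _ e.
by apply: ribbon_from_eq; rewrite /from_val e /= w1 mulg1.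
Qed.

Lemma ribbon_atom_rdiv (P : Rp) (u a : into P) :
  is_atom (projT2 u) -> is_atom (projT2 a) -> rdiv u a -> u = a.
Proof.
move=> [u1 _] [_ aat] [w e]; have [/ribbon_is_identityE w1|/u1//] := aat _ _ _ e.
by apply: ribbon_into_eq; rewrite /into_val e /= w1 mul1g.
Qed.

(** * Functors induced by automorphisms of the monoid fixing Delta *)

Section Transport.
Variables (f g : M -> M) (fg : delta_automorphism G f g).

(** This is the image [f(P)], written as a preimage under the inverse [g]. *)
Definition transport_obj (P : Rp) : Rp :=
  exist _ [set m | proj1_sig P (g m)]
    (preimage_parabolic hA (delta_automorphism_sym fg) (proj2_sig P)).

Lemma transport_subproof (P Q : Rp) (h : hom P Q) :
  conj_set (j @` proj1_sig (transport_obj P)) (j (f (proj1_sig h))) =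
  j @` proj1_sig (transport_obj Q).
Proof.
have [fK gK fM _] := fg.
have /(conj_set_normalizes G hA)[PQ QP] := proj2_sig h.
apply/(conj_set_normalizes G hA); split=> m /= Pm.
  have [q Qq e] := PQ _ Pm; exists (f q); first by rewrite /= fK.
  by rewrite -fM -e fM gK.
have [p Pp e] := QP _ Pm; exists (f p); first by rewrite /= fK.
by rewrite -fM e fM gK.
Qed.

Definition transport_mor (P Q : Rp) (h : hom P Q) :
    hom (transport_obj P) (transport_obj Q) :=
  exist _ (f (proj1_sig h)) (transport_subproof h).

Lemma transport_mor1 (P : Rp) : transport_mor (idm P) = idm (transport_obj P).
Proof.
have [_ _ fM _] := fg; apply: sig_val_inj => /=.
by apply: (mulMI G (a := f 1)); rewrite -fM !mulg1.
Qed.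

Lemma transport_morM (P Q R : Rp) (h : hom P Q) (k : hom Q R) :
  transport_mor (cmp h k) = cmp (transport_mor h) (transport_mor k).
Proof. by have [_ _ fM _] := fg; apply: sig_val_inj; rewrite /= fM. Qed.

Definition transport : functor Rp Rp := Functor transport_mor1 transport_morM.

End Transport.

Lemma transportK (f g : M -> M) (fg : delta_automorphism G f g)
    (gf : delta_automorphism G g f) :
  functor_eq (comp_functor (transport fg) (transport gf)) (id_functor Rp).
Proof.
have [fK _ _ _] := fg.
have objK P : transport_obj gf (transport_obj fg P) = P.
  by apply: sig_val_inj; apply/funext => m /=; rewrite fK.
by move=> P Q h; apply: ribbon_Mor_eq => //=; rewrite ?objK ?fK.
Qed.

Definition ribbon_Phi : functor Rp Rp := transport (shift_automorphism G).

Lemma ribbon_Phi_automorphism : is_automorphism ribbon_Phi.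
Proof.
exists (transport (delta_automorphism_sym (shift_automorphism G))).
by split; apply: transportK.
Qed.

Lemma ribbon_Delta_subproof (P : Rp) :
  conj_set (j @` proj1_sig P) (j D) = j @` proj1_sig (ribbon_Phi P).
Proof.
apply/(conj_set_normalizes G hA); split=> p Pp.
  by exists (shift G p); rewrite /= ?shiftK // delta_shift.
by exists (shiftV G p) => //; rewrite -delta_shift shiftVK.
Qed.

Definition ribbon_Delta (P : Rp) : hom P (ribbon_Phi P) :=
  exist _ D (ribbon_Delta_subproof P).

Lemma ribbon_Delta_natural (P Q : Rp) (v : hom P Q) :
  cmp (ribbon_Delta P) (fmor ribbon_Phi v) = cmp v (ribbon_Delta Q).
Proof. by apply: sig_val_inj; rewrite /= delta_shift. Qed.

Lemma deltaX_from (P : Rp) (n : nat) : exists u : from P, from_val u = D ^+ n.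
Proof.
elim: n => [|n [u uE]]; first by exists (existT _ P (idm P)).
exists (existT _ _ (cmp (projT2 u) (ribbon_Delta _))).
by rewrite /from_val /= expgSr -uE.
Qed.

Lemma deltaX_into (P : Rp) (n : nat) : exists u : into P, into_val u = D ^+ n.
Proof.
elim: n => [|n [u uE]]; first by exists (existT (fun Q => hom Q P) P (idm P)).
have gf := delta_automorphism_sym (shift_automorphism G).
(* [Q] is the inverse shift of the current source, so that [D] is a ribbon from [Q] to that
   source. *)
pose Q := transport gf (projT1 u).
have h : conj_set (j @` proj1_sig Q) (j D) = j @` proj1_sig (projT1 u).
  rewrite (proj2_sig (ribbon_Delta Q)); congr (_ @` _).
  by apply/funext => m; rewrite /= shiftVK.
exists (existT (fun Q => hom Q P) Q (@cmp Rp _ _ _ (exist _ D h) (projT2 u))).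
by rewrite /into_val /= expgS -uE.
Qed.

Lemma ribbon_upper_bound (P : Rp) (u v : from P) :
  exists w, ldiv u w /\ ldiv v w.
Proof.
have [a [c ac]] := mldiv_deltaX G (from_val u).
have [b [d bd]] := mldiv_deltaX G (from_val v).
have [w wE] := deltaX_from P (a + b); exists w.
split; apply/ribbon_ldivE; rewrite wE.
  by exists (c * D ^+ b); rewrite expgnDr ac mulgA.
by exists (d * D ^+ a); rewrite addnC expgnDr bd mulgA.
Qed.

Lemma ribbon_upper_bound_into (P : Rp) (u v : into P) :
  exists w, rdiv u w /\ rdiv v w.
Proof.
have [a [c ac]] := mrdiv_deltaX G (into_val u).
have [b [d bd]] := mrdiv_deltaX G (into_val v).
have [w wE] := deltaX_into P (a + b); exists w.
split; apply/ribbon_rdivE; rewrite wE.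
  by exists (D ^+ b * c); rewrite addnC expgnDr ac mulgA.
by exists (D ^+ a * d); rewrite expgnDr bd mulgA.
Qed.

(** Any atom [s] of [M] dividing [a] makes [nu P s] divide [a], and an atom dividing an atom equals
    it. *)
Lemma ribbon_atom_nu (nu : forall P : Rp, atom_of M -> from P)
    (nu_atom : forall P s, is_atom (projT2 (nu P s)))
    (nu_ldiv : forall P s (g : from P),
       mldiv (proj1_sig s) (from_val g) -> ldiv (nu P s) g)
    (P : Rp) (a : from P) :
  is_atom (projT2 a) -> exists2 s, nu P s = a & mldiv (proj1_sig s) (from_val a).
Proof.
move=> aat; have /(atom_mldiv_exists G)[s sa] : from_val a <> 1.
  by move/ribbon_is_identityE; case: aat.
by exists s => //; apply: ribbon_atom_ldiv => //; apply: nu_ldiv.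
Qed.

Lemma ribbon_atom_nut (nut : forall P : Rp, atom_of M -> into P)
    (nut_atom : forall P s, is_atom (projT2 (nut P s)))
    (nut_rdiv : forall P s (g : into P),
       mrdiv (proj1_sig s) (into_val g) -> rdiv (nut P s) g)
    (P : Rp) (a : into P) : is_atom (projT2 a) -> exists s, nut P s = a.
Proof.
move=> aat; have /(atom_mrdiv_exists G)[s sa] : into_val a <> 1.
  by move/ribbon_is_identityE; case: aat.
by exists s; apply: ribbon_atom_rdiv => //; apply: nut_rdiv.
Qed.

Lemma ribbon_garside : has_nu_structure G j -> is_garside_category Rp.
Proof.
move=> [[nu [nu_atom nu_ldiv nu_join]] [nut [nut_atom nut_rdiv nut_join]]].
constructor; apply: (@GarsideStructure Rp ribbon_Phi ribbon_Delta).
- exact: ribbon_noetherian.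
- exact: ribbon_cancellative.
- exact: ribbon_Phi_automorphism.
- exact: ribbon_Delta_natural.
- apply: ldiv_is_lattice.
  + exact: ribbon_noetherian.
  + exact: ribbon_cancellative.
  + exact: ribbon_upper_bound.
  move=> P a b /(ribbon_atom_nu nu_atom nu_ldiv)[s <- _].
  move=> /(ribbon_atom_nu nu_atom nu_ldiv)[t <- _].
  have [m mJ] := mldiv_join G (from_val (nu P s)) (from_val (nu P t)).
  have [g gm] := nu_join _ _ _ _ mJ; exists g.
  rewrite -gm in mJ; have [sg tg gmin] := mJ.
  split; [exact/ribbon_ldivE|exact/ribbon_ldivE|].
  by move=> c /ribbon_ldivE sc /ribbon_ldivE tc; apply/ribbon_ldivE/gmin.
- apply: rdiv_is_lattice.
  + exact: ribbon_noetherian.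
  + exact: ribbon_cancellative.
  + exact: ribbon_upper_bound_into.
  move=> P a b /(ribbon_atom_nut nut_atom nut_rdiv)[s <-].
  move=> /(ribbon_atom_nut nut_atom nut_rdiv)[t <-].
  have [m mJ] := mrdiv_join G (into_val (nut P s)) (into_val (nut P t)).
  have [g gm] := nut_join _ _ _ _ mJ; exists g.
  rewrite -gm in mJ; have [sg tg gmin] := mJ.
  split; [exact/ribbon_rdivE|exact/ribbon_rdivE|].
  by move=> c /ribbon_rdivE sc /ribbon_rdivE tc; apply/ribbon_rdivE/gmin.
- move=> P Q v vat; have [[s sat] /= nus sv] :=
    ribbon_atom_nu nu_atom nu_ldiv (a := existT _ Q v) vat.
  (* The atom [s] of [M] divides [D], so [v = nu P s] divides the ribbon [D]. *)
  have [v' v'E] : ldiv (existT _ Q v) (existT _ _ (ribbon_Delta P)).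
    rewrite -nus; apply: nu_ldiv => /=.
    have [s' [e _]] := Delta_atom G sat; exists s'; exact: esym e.
  exists v'; split; first exact: esym v'E.
  have /(congr1 (fun k => proj1_sig k))/= e := v'E.
  (* The second identity follows by cancelling [v] in [v v' Phi(v) = D Phi(v) = v D]. *)
  apply: sig_val_inj; apply: (mulMI G (a := proj1_sig v)).
  by rewrite /= mulgA -e delta_shift.
Qed.

End RibbonCategory.

(** * The ribbon groupoid *)

Lemma groupoid_cancel (C : category) : is_groupoid C ->
  forall (x y z : C) (f g : hom x y) (h : hom y z), cmp f h = cmp g h -> f = g.
Proof.
move=> C_groupoid x y z f g h e; have [k [hk _]] := C_groupoid _ _ h.
by rewrite -[f]cmpm1 -[g]cmpm1 -hk !cmpA e.
Qed.

Lemma groupoid_Mor_cancel (C : category) : is_groupoid C ->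
  forall (x y z x' y' z' : C) (f : hom x y) (h : hom y z)
    (f' : hom x' y') (h' : hom y' z'),
  Mor h = Mor h' -> Mor (cmp f h) = Mor (cmp f' h') -> Mor f = Mor f'.
Proof.
move=> C_groupoid x y z x' y' z' f h f' h' eh efh.
have exx : x = x' := existT_inj1 efh; have eyy : y = y' := existT_inj1 eh.
subst x' y'; have ezz : z = z' := existT_inj1 (existT_inj eh).
subst z'; have {}eh := existT_inj (existT_inj eh); subst h'.
by rewrite (groupoid_cancel C_groupoid (existT_inj (existT_inj efh))).
Qed.

Section RibbonGroupoid.
Variables (M : monoidType) (G : monoidal_garside_structure M).
Variables (A : groupType) (j : UMagmaMorphism.type M A).
Hypothesis hA : is_group_of_fractions j.

Local Notation Rp := (positive_ribbon_category G j).
Local Notation Rg := (ribbon_groupoid G j).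

Lemma ribbon_groupoid_is_groupoid : is_groupoid Rg.
Proof.
move=> K L [x xE]; have x'E : conj_set (positive_part L) x^-1 = positive_part K.
  by rewrite -xE -conj_setM mulgV conj_set1.
by exists (exist _ x^-1 x'E); split; apply: sig_val_inj; rewrite /= ?mulgV ?mulVg.
Qed.

Definition standard_of (P : Rp) : Rg :=
  exist _ (generated_subgroup (j @` proj1_sig P))
    (ex_intro2 _ _ _ (proj2_sig P) erefl).

Lemma positive_part_standard_of (P : Rp) :
  positive_part (standard_of P) = j @` proj1_sig P.
Proof.
apply/seteqP; split=> [y [/= gm [m _ e]]|_ [p Pp <-]].
  move: gm; rewrite -{y}e => /(generated_subgroup_range hA (proj2_sig P)) Pm.
  by exists m.
by split; [move=> H [_]; apply; exists p|exists p].
Qed.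

Lemma ribbon_inclusion_subproof (P Q : Rp) (g : hom P Q) :
  conj_set (positive_part (standard_of P)) (j (proj1_sig g)) =
  positive_part (standard_of Q).
Proof. by rewrite !positive_part_standard_of (proj2_sig g). Qed.

Definition ribbon_inclusion_mor (P Q : Rp) (g : hom P Q) :
    hom (standard_of P) (standard_of Q) :=
  exist _ (j (proj1_sig g)) (ribbon_inclusion_subproof g).

Lemma ribbon_inclusion1 (P : Rp) :
  ribbon_inclusion_mor (idm P) = idm (standard_of P).
Proof. exact/sig_val_inj/gmulf1. Qed.

Lemma ribbon_inclusionM (P Q R : Rp) (g : hom P Q) (h : hom Q R) :
  ribbon_inclusion_mor (cmp g h) =
  cmp (ribbon_inclusion_mor g) (ribbon_inclusion_mor h).
Proof. exact/sig_val_inj/gmulfM. Qed.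

Definition ribbon_inclusion : functor Rp Rg :=
  Functor ribbon_inclusion1 ribbon_inclusionM.

Lemma standard_of_surj (K : Rg) : exists P : Rp, standard_of P = K.
Proof.
by have [P HP e] := proj2_sig K; exists (exist _ P HP); apply: sig_val_inj.
Qed.

Lemma standard_of_inj : injective standard_of.
Proof.
move=> P Q e; apply: (parabolic_eq hA).
by rewrite -!positive_part_standard_of e.
Qed.

(** A choice of preimage, unique because [standard_of] is injective. *)
Definition parabolic_of (K : Rg) : Rp := projT1 (cid (standard_of_surj K)).

Lemma parabolic_ofK : cancel parabolic_of standard_of.
Proof. by move=> K; rewrite /parabolic_of; case: cid. Qed.

Lemma standard_ofK : cancel standard_of parabolic_of.
Proof. by move=> P; apply: standard_of_inj; rewrite parabolic_ofK. Qed.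

Lemma ribbon_fraction (P Q : Rp) (x : A) :
  conj_set (j @` proj1_sig P) x = j @` proj1_sig Q ->
  exists (R : Rp) (a : hom P R) (d : hom Q R), x * j (proj1_sig d) = j (proj1_sig a).
Proof.
move=> PQ; have [m [n e]] := frac_decomposition G hA x.
have [[R d] dE] := deltaX_from hA Q n; rewrite /from_val /= in dE.
have aE : conj_set (j @` proj1_sig P) (j m) = j @` proj1_sig R.
  by rewrite -e -gmulfXn -dE conj_setM PQ (proj2_sig d).
by exists R, (exist _ m aE), d; rewrite dE gmulfXn.
Qed.

Lemma parabolic_of_conj (K L : Rg) (x : hom K L) :
  conj_set (j @` proj1_sig (parabolic_of K)) (proj1_sig x) =
  j @` proj1_sig (parabolic_of L).
Proof.
by rewrite -!positive_part_standard_of !parabolic_ofK (proj2_sig x).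
Qed.

Lemma ribbon_common_multiple (Q R R' : Rp) (d : hom Q R) (d' : hom Q R') :
  exists (S : Rp) (e : hom R S) (e' : hom R' S), cmp d e = cmp d' e'.
Proof.
have [[S c] [[e ce] [e' ce']]] :=
  ribbon_upper_bound hA (existT _ R d) (existT _ R' d').
by exists S, e, e'; rewrite -[LHS]ce.
Qed.

(** * Extension of a functor from positive ribbons to their fractions *)

Section Extension.
Variables (C : category) (C_groupoid : is_groupoid C) (F : functor Rp C).

(* [h] is the image [F a (F d)^-1] of [x = a d^-1], whatever the fraction *)
Definition extends_at (K L : Rg) (x : A)
    (h : hom (F (parabolic_of K)) (F (parabolic_of L))) : Prop :=
  forall (R : Rp) (a : hom (parabolic_of K) R) (d : hom (parabolic_of L) R),
    x * j (proj1_sig d) = j (proj1_sig a) -> cmp h (fmor F d) = fmor F a.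

Lemma extends_at_exists (K L : Rg) (x : hom K L) :
  exists h, extends_at (K := K) (L := L) (proj1_sig x) h.
Proof.
have [R [a [d xE]]] := ribbon_fraction (parabolic_of_conj x).
have [d' [_ dd']] := C_groupoid (fmor F d).
exists (cmp (fmor F a) d') => R' b c xE'.
(* Two fractions [a d^-1] and [b c^-1] of [x] are compared over a common denominator [d e = c e'],
   where also [a e = b e']. *)
have [S [e [e' de]]] := ribbon_common_multiple d c.
have abe : cmp a e = cmp b e'.
  apply/sig_val_inj/(group_of_fractions_inj G hA).
  rewrite /= !gmulfM -xE -xE' -!mulgA -!gmulfM; congr (_ * j _).
  exact: (congr1 (fun k => proj1_sig k) de).
apply: (groupoid_cancel C_groupoid (h := fmor F e')).
rewrite -[LHS]cmpA -!fmorM -de -abe !fmorM -cmpA (cmpA d') dd'.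
by rewrite cmp1m.
Qed.

Lemma extends_at_unique (K L : Rg) (x : hom K L) h h' :
  extends_at (K := K) (L := L) (proj1_sig x) h ->
  extends_at (K := K) (L := L) (proj1_sig x) h' -> h = h'.
Proof.
have [R [a [d xE]]] := ribbon_fraction (parabolic_of_conj x).
move=> /(_ _ _ _ xE) e /(_ _ _ _ xE) e'.
by apply: (groupoid_cancel C_groupoid (h := fmor F d)); rewrite e e'.
Qed.

Definition extension_mor (K L : Rg) (x : hom K L) :
    hom (F (parabolic_of K)) (F (parabolic_of L)) :=
  projT1 (cid (extends_at_exists x)).

Lemma extension_morP (K L : Rg) (x : hom K L) :
  extends_at (proj1_sig x) (extension_mor x).
Proof. by rewrite /extension_mor; case: cid. Qed.

Lemma extension1 (K : Rg) : extension_mor (idm K) = idm _.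
Proof.
apply: (extends_at_unique (@extension_morP _ _ (idm K))) => R a d.
rewrite /= mul1g => /(group_of_fractions_inj G hA)/sig_val_inj ->.
by rewrite cmp1m.
Qed.

Lemma extensionM (K L N : Rg) (x : hom K L) (y : hom L N) :
  extension_mor (cmp x y) = cmp (extension_mor x) (extension_mor y).
Proof.
apply: (extends_at_unique (@extension_morP _ _ (cmp x y))) => R a d xyE.
have [R' [b [c yE]]] := ribbon_fraction (parabolic_of_conj y).
have [S [e [e' de]]] := ribbon_common_multiple d c.
have /= deE : _ = _ := congr1 (fun k => proj1_sig k) de.
(* From [x y = a d^-1], [y = b c^-1] and [d e = c e'], the fraction [(a e) (b e')^-1] represents
   [x]. *)
have xbe : proj1_sig x * j (proj1_sig (cmp b e')) = j (proj1_sig (cmp a e)).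
  rewrite /= !gmulfM -yE -xyE -!mulgA; congr (_ * (_ * _)).
  by rewrite -!gmulfM deE.
apply: (groupoid_cancel C_groupoid (h := fmor F e)).
rewrite -!cmpA -!fmorM de fmorM (cmpA _ _ (fmor F e')).
rewrite (extension_morP yE) -fmorM (extension_morP xbe).
by [].
Qed.

Definition extension : functor Rg C := Functor extension1 extensionM.

Lemma extensionE : functor_eq (comp_functor ribbon_inclusion extension) F.
Proof.
move=> P Q f /=.
have fE :
    conj_set (j @` proj1_sig (parabolic_of (standard_of P))) (j (proj1_sig f)) =
    j @` proj1_sig (parabolic_of (standard_of Q)).
  by rewrite !standard_ofK (proj2_sig f).
(* [parabolic_of (standard_of P)] is only propositionally [P], so [f] is retyped before being read
   as the fraction with denominator [1]. *)
pose f' : hom (parabolic_of (standard_of P)) (parabolic_of (standard_of Q)) :=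
  exist _ _ fE.
have -> : extension_mor (ribbon_inclusion_mor f) = fmor F f'.
  rewrite -[LHS]cmpm1 -fmor1; apply: extension_morP.
  by rewrite /= gmulf1 mulg1.
have FE P' Q' (g : hom P' Q') : P' = P -> Q' = Q -> proj1_sig g = proj1_sig f ->
    Mor (fmor F g) = Mor (fmor F f).
  by move=> eP eQ; subst P' Q' => /sig_val_inj ->.
by apply: FE => //; apply: standard_ofK.
Qed.

End Extension.

(** On [x = a d^-1], a functor to a groupoid is forced by its values on the positive ribbons [a] and
    [d]. *)
Lemma ribbon_functor_unique (C : category) (H H' : functor Rg C) :
  is_groupoid C ->
  functor_eq (comp_functor ribbon_inclusion H) (comp_functor ribbon_inclusion H') ->
  functor_eq H H'.
Proof.
move=> C_groupoid HH' K L.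
have [P eK] := standard_of_surj K; have [Q eL] := standard_of_surj L.
subst K L => x.
have [R [a [d xE]]] : exists (R : Rp) (a : hom P R) (d : hom Q R),
    proj1_sig x * j (proj1_sig d) = j (proj1_sig a).
  by apply: ribbon_fraction; rewrite -!positive_part_standard_of (proj2_sig x).
apply: (groupoid_Mor_cancel C_groupoid (HH' _ _ d)).
have xd : cmp x (fmor ribbon_inclusion d) = fmor ribbon_inclusion a.
  exact: sig_val_inj.
by rewrite -!fmorM xd; apply: HH'.
Qed.

Lemma ribbon_formal_inverses : is_groupoid_of_formal_inverses ribbon_inclusion.
Proof.
split=> [|C C_groupoid F]; first exact: ribbon_groupoid_is_groupoid.
exists (extension C_groupoid F); split=> [|H HF]; first exact: extensionE.
apply: ribbon_functor_unique => // P Q g.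
by rewrite [LHS]HF (extensionE C_groupoid F).
Qed.

End RibbonGroupoid.

Theorem theorem1p1 (M : monoidType) (G : monoidal_garside_structure M)
    (A : groupType) (j : UMagmaMorphism.type M A)
    (hA : is_group_of_fractions j) (hnu : has_nu_structure G j) :
  is_garside_category (positive_ribbon_category G j) /\
  exists I : functor (positive_ribbon_category G j) (ribbon_groupoid G j),
    [/\ forall P : positive_ribbon_category G j,
          proj1_sig (I P) = generated_subgroup (j @` proj1_sig P),
        forall (P Q : positive_ribbon_category G j) (g : hom P Q),
          proj1_sig (fmor I g) = j (proj1_sig g)
      & is_groupoid_of_formal_inverses I].
Proof.
split; first exact: ribbon_garside.
by exists (ribbon_inclusion G hA); split=> //; apply: ribbon_formal_inverses.
Qed.
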